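(* Consider the following model. For $\bm{u}\in\mathbb{R}^n$, $\bm{a}\in\mathbb{R}^n_+$, $b\in\mathbb{R}_+$, let $\mathrm{LP}(\bm{u},\bm{a},b)$ denote the linear program $\max_{\bm{x}}\sum_{i=1}^n u_ix_i$ subject to $\sum_{i=1}^n a_ix_i\le b$ and $0\le x_i\le 1$ for $i=1,\dots,n$. For $\bm{\theta}=(\bm{\mu},\kappa)\in\mathcal{S}^{n-1}\times(0,\infty)$ let $f(\cdot;\bm{\theta})$ be the probability density on $\mathcal{S}^{n-1}$ (w.r.t. surface measure) $$f(\bm{u};\bm{\theta})=\frac{\exp(-\kappa\bm{\mu}^\top\bm{u})}{\int_{\mathcal{S}^{n-1}}\exp(-\kappa\bm{\mu}^\top\bm{v})\,d\bm{v}}.$$ Let $\mathcal{P}_{\bm{a},b}$ be an (unknown) distribution on $\mathbb{R}^n_+\times\mathbb{R}_+$ such that there is $\underline{a}>0$ with $a_i\in[\underline{a},1]$ almost surely for all $i$. For a parameter $\bm{\theta}$, let $\mathbb{P}((\bm{x}^*,\bm{a},b)\mid\bm{\theta})$ denote the joint law of $(\bm{x}^*,\bm{a},b)$ generated by drawing $\bm{u}\sim f(\cdot;\bm{\theta})$ and, independently, $(\bm{a},b)\sim\mathcal{P}_{\bm{a},b}$, and letting $\bm{x}^*$ be the (almost surely unique) optimal solution of $\mathrm{LP}(\bm{u},\bm{a},b)$. Fix known constants $0<\underline{\kappa}<\bar{\kappa}$ and a true parameter $\bm{\theta}^*=(\bm{\mu}^*,\kappa^* )$ with $\bm{\mu}^*\in\mathcal{S}^{n-1}$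 and $\kappa^*\in(\underline{\kappa},\bar{\kappa})$. The data $\mathcal{D}_T=\{(\bm{x}^*_t,\bm{a}_t,b_t)\}_{t=1}^T$ consist of $T$ i.i.d. draws from $\mathbb{P}(\cdot\mid\bm{\theta}^* )$. Let $\mathbb{P}_0$ be the uniform distribution on $\mathcal{S}^{n-1}\times(\underline{\kappa},\bar{\kappa})$, and let $\mathbb{P}_T$ be the posterior distribution on $\mathcal{S}^{n-1}\times(\underline{\kappa},\bar{\kappa})$ with density $$\mathbb{P}_T(\bm{\theta})\propto\mathbb{P}_0(\bm{\theta})\prod_{t=1}^T\int_{\bm{u}\in\mathcal{U}_t}f(\bm{u};\bm{\theta})\,d\bm{u},\qquad \mathcal{U}_t=\{\bm{u}\in\mathcal{S}^{n-1}:\bm{x}^*_t\text{ is an optimal solution of }\mathrm{LP}(\bm{u},\bm{a}_t,b_t)\}.$$ For $\alpha\in[0,1/2]$ define $$\Theta_T\coloneqq\left\{\bm{\theta}\in\mathcal{S}^{n-1}\times(\underline{\kappa},\bar{\kappa}):\ \mathcal{W}\big(\mathbb{P}((\bm{x}^*,\bm{a},b)\mid\bm{\theta}),\mathbb{P}((\bm{x}^*,\bm{a},b)\mid\bm{\theta}^* )\big)\le\max(8,8\bar{\kappa})\frac{n\log T}{T^{1/2-\alpha}}\right\},$$ where $\mathcal{W}$ is the Wasserstein distance between distributions on $[0,1]^n\times\mathbb{R}^n_+\times\mathbb{R}_+$ equipped with the Euclidean metric. Then for any $\alpha\in[0,1/2]$, $1-\mathbb{P}_T(\Theta_T)\to 0$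 in probability as $T\to\infty$; specifically, $$\mathbb{E}\left[\mathbb{P}_T(\Theta_T)\right]\ge 1-\frac{2}{T}-\frac{1}{4T^{2\alpha}\log^2 T},$$ where the expectation is over the dataset $\mathcal{D}_T$.
   Context: $\mathcal{S}^{n-1}=\{\bm{u}\in\mathbb{R}^n:\|\bm{u}\|_2=1\}$. The posterior $\mathbb{P}_T$ depends on $\mathcal{D}_T$ and is therefore a random probability measure; $\mathbb{P}_T(\Theta_T)$ denotes the posterior mass of the set $\Theta_T$. *)

(* Defs.v *)
From HB Require Import structures.
From mathcomp Require Import all_boot all_order all_algebra.
From mathcomp Require Import all_classical all_reals all_analysis.
Set Implicit Arguments. Unset Strict Implicit. Unset Printing Implicit Defensive.
Import Order.TTheory GRing.Theory Num.Theory.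
Import numFieldNormedType.Exports.
Local Open Scope classical_set_scope.
Local Open Scope ring_scope.

(* Vectors of R^n are n.-tuple R (which carries the product sigma-algebra,
   i.e. the Borel sigma-algebra of R^n, in MathComp-Analysis). *)
Section Model.
Context {R : realType} {n : nat}.

Definition dotp (u v : n.-tuple R) : R := \sum_(i < n) tnth u i * tnth v i.
Definition sqdist (u v : n.-tuple R) : R := \sum_(i < n) (tnth u i - tnth v i) ^+ 2.

Definition sphere : set (n.-tuple R) := [set u | dotp u u = 1].

Definition tscale (r : R) (u : n.-tuple R) : n.-tuple R := [tuple r * tnth u i | i < n].

Definition is_lebesgue_n (lam : {measure set (n.-tuple R) -> \bar R}) : Prop :=
  forall a b : n.-tuple R,
    lam [set x | forall i, tnth a i <= tnth x i <= tnth b i] =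
    (\prod_(i < n) Num.max (tnth b i - tnth a i) 0)%:E.

Definition cone (A : set (n.-tuple R)) : set (n.-tuple R) :=
  [set x | exists r u, 0 < r <= 1 /\ A u /\ x = tscale r u].

(* sig is the surface measure on S^{n-1} (cone construction from Lebesgue
   measure), viewed as a measure on R^n concentrated on the sphere *)
Definition is_surface_measure (lam sig : {measure set (n.-tuple R) -> \bar R}) : Prop :=
  forall A, measurable A -> (sig A = (n%:R)%:E * lam (cone (A `&` sphere)))%E.

Definition LP_feasible (a : n.-tuple R) (b : R) (x : n.-tuple R) : Prop :=
  dotp a x <= b /\ forall i, 0 <= tnth x i <= 1.
Definition LP_optimal (u a : n.-tuple R) (b : R) (x : n.-tuple R) : Prop :=
  LP_feasible a b x /\ forall y, LP_feasible a b y -> dotp u y <= dotp u x.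

Definition param := (n.-tuple R * R)%type.
(* observations z = (x*, (a, b)) *)
Definition obs := (n.-tuple R * (n.-tuple R * R))%type.

Local Open Scope ereal_scope.

Definition vmf_norm (sig : {measure set (n.-tuple R) -> \bar R}) (th : param) : R :=
  fine (\int[sig]_(v in sphere) (expR (- th.2 * dotp th.1 v))%:E).
Definition vmf_density (sig : {measure set (n.-tuple R) -> \bar R}) (th : param)
    (u : n.-tuple R) : R :=
  (expR (- th.2 * dotp th.1 u) / vmf_norm sig th)%R.

(* integral of h : obs -> \bar R against the law P((x*,a,b) | theta):
   u ~ f(.;theta), (a,b) ~ Pab independent, x* = xs u (a,b) *)
Definition law_int (sig : {measure set (n.-tuple R) -> \bar R})
    (Pab : probability (n.-tuple R * R)%type R)
    (xs : n.-tuple R -> n.-tuple R * R -> n.-tuple R) (th : param)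
    (h : obs -> \bar R) : \bar R :=
  \int[sig]_(u in sphere)
     ((\int[Pab]_ab h (xs u ab, ab)) * (vmf_density sig th u)%:E).

Definition obs_dist (z z' : obs) : R :=
  Num.sqrt (sqdist z.1 z'.1 + sqdist z.2.1 z'.2.1 + (z.2.2 - z'.2.2) ^+ 2)%R.

Definition coupling (sig : {measure set (n.-tuple R) -> \bar R})
    (Pab : probability (n.-tuple R * R)%type R)
    (xs : n.-tuple R -> n.-tuple R * R -> n.-tuple R)
    (th1 th2 : param) (g : probability (obs * obs)%type R) : Prop :=
  forall A : set obs, measurable A ->
    g (A `*` setT) = law_int sig Pab xs th1 (fun z => (\1_A z)%:E) /\
    g (setT `*` A) = law_int sig Pab xs th2 (fun z => (\1_A z)%:E).

Definition wasserstein (sig : {measure set (n.-tuple R) -> \bar R})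
    (Pab : probability (n.-tuple R * R)%type R)
    (xs : n.-tuple R -> n.-tuple R * R -> n.-tuple R)
    (th1 th2 : param) : \bar R :=
  ereal_inf [set \int[g]_p (obs_dist p.1 p.2)%:E |
             g in [set g | coupling sig Pab xs th1 th2 g]].

Definition Uset (z : obs) : set (n.-tuple R) :=
  [set u | sphere u /\ LP_optimal u z.2.1 z.2.2 z.1].

Definition likelihood (sig : {measure set (n.-tuple R) -> \bar R}) (D : seq obs) (th : param) : R :=
  (\prod_(z <- D) fine (\int[sig]_(u in Uset z) (vmf_density sig th u)%:E))%R.

Definition posterior_mass (sig : {measure set (n.-tuple R) -> \bar R}) (klo khi : R) (D : seq obs) (Theta : set param) : R :=
  (fine (\int[sig]_(m in sphere) \int[lebesgue_measure]_(k in [set k : R | (klo < k < khi)%R])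
          (\1_Theta (m, k) * likelihood sig D (m, k))%:E)
   / fine (\int[sig]_(m in sphere) \int[lebesgue_measure]_(k in [set k : R | (klo < k < khi)%R])
          (likelihood sig D (m, k))%:E))%R.

(* expectation of g over T i.i.d. draws, given the one-draw integral L *)
Fixpoint iid_expect (L : (obs -> \bar R) -> \bar R) (T : nat) (g : seq obs -> \bar R)
  : \bar R :=
  match T with
  | 0 => g [::]
  | T'.+1 => L (fun z => iid_expect L T' (fun s => g (z :: s)))
  end.

End Model.

(* Main.v *)
(** The optimal solution of a fractional knapsack problem is, for almost every objective [u], the
    vertex determined by its pattern of coordinates equal to 0, equal to 1 and fractional; given
    [(a, b)], the solution is thus a random element of a finite set, whose probabilities [pr] are the
    factors of the likelihood.  A maximal coupling of two such laws, and the bound of the total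
    variation by the Hellinger affinity, show that a parameter whose affinity with the true one is
    close to 1 is close to it in Wasserstein distance.

    For the remaining parameters, write [L] for the likelihood and [E] for the evidence.  The
    likelihood is log-Lipschitz, so [L <= C * E] with [C] the inverse prior mass of a ball of radius
    [1 / T] up to a constant.  Applying this at [th] and at the true parameter [th0],
    [L th / E <= C * sqrt (L th / L th0)], and the expectation of the right-hand side is [C] times
    the [T]-th power of the affinity.

    The set [Theta_T] is not known to be measurable: the argument bounds the posterior mass from
    below by that of a measurable subset, and the expectation by induction on the number of
    observations, using only that lower integrals are monotone. *)

Require Import Defs.
From HB Require Import structures.
From mathcomp Require Import all_boot all_order all_algebra.
From mathcomp Require Import all_classical all_reals all_analysis.
From mathcomp Require Import measurable_realfun ring lra.
Import Order.TTheory GRing.Theory Num.Theory.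
Import numFieldNormedType.Exports.
Local Open Scope classical_set_scope.
Local Open Scope ring_scope.
Set Implicit Arguments.
Unset Strict Implicit.
Unset Printing Implicit Defensive.

(** Square roots are what make the argument decay: the likelihood ratio itself has mean at most 1
    with no guaranteed decrease in [T], whereas its square root has the affinity as mean, once per
    observation. The inequality [L <= C * E] is used at both parameters, and the geometric mean of
    the two uses produces the square root; no tests or covering numbers are needed.

    The constants are tied together as follows. With [M = max 1 khi] and [e = 8 M n log T / sqrt T],
    the radius at [alpha = 0], the threshold on [1 - affinity] is [eta = e^2 / (2 n) = 32 M^2 n (log
    T)^2 / T], exactly what the Wasserstein estimate turns into [e]. Beyond the threshold the [T]-th
    power of the affinity is at most [exp (- T eta) = exp (- 32 M^2 n (log T)^2)], which must beat
    [C] times the total prior mass, a quantity of order [(n^2 M T)^n] up to constants and lower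
    powers. If [eta > 1] no parameter lies beyond the threshold; if [eta <= 1], both [n] and [M^2]
    are at most of the order of [T], and the exponential wins. The outcome is the bound
    [1 - 1 / T]. *)

(** * Integration and measurability tools *)

Section MeasureFacts.
Context d (T : measurableType d) (R : realType).
Local Open Scope ereal_scope.

(* The integral of a nonnegative function is a supremum over the simple functions below it, so that
   monotonicity needs no measurability. *)
Lemma le_lower_integral (mu : {measure set T -> \bar R}) (D : set T) (f g : T -> \bar R) :
  (forall x, D x -> 0 <= f x) -> (forall x, D x -> f x <= g x) ->
  \int[mu]_(x in D) f x <= \int[mu]_(x in D) g x.
Proof.
move=> f0 fg; rewrite !ge0_integralE//; last first.
  by move=> x Dx; exact: (le_trans (f0 x Dx) (fg x Dx)).
apply: le_ereal_sup => _ [h hf <-]; exists h => // x.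
apply: (le_trans (hf x)); rewrite !patchE; case: ifPn => // /[!inE] Dx.
exact: fg.
Qed.

(** Repackages a measure of finite mass with the structure that the Fubini theorems require; the two
    agree only as set functions. *)
Lemma exists_finite_measure (mu : {measure set T -> \bar R}) :
  mu setT < +oo -> exists s : {finite_measure set T -> \bar R}, forall A, s A = mu A.
Proof.
move=> muT.
by exists (mfrestr measurableT muT) => A; rewrite /= /mfrestr /mrestr setIT.
Qed.

Lemma integral_EFinZl (mu : {measure set T -> \bar R}) (k : R) (f : T -> R) :
  (0 <= k)%R -> measurable_fun setT f -> (forall x, (0 <= f x)%R) ->
  \int[mu]_x (k * f x)%:E = k%:E * \int[mu]_x (f x)%:E.
Proof.
move=> k0 mf f0; under eq_integral do rewrite EFinM.
by rewrite ge0_integralZl//; [exact/measurable_EFinP|move=> x _; rewrite lee_fin].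
Qed.

Lemma ge0_integral_le_measure (mu : {measure set T -> \bar R}) (f : T -> R) (c : R) :
  measurable_fun setT f -> (forall x, (0 <= f x)%R) -> (forall x, (f x <= c)%R) ->
  \int[mu]_x (f x)%:E <= c%:E * mu setT.
Proof.
move=> mf f0 fc; rewrite -integral_cst//; apply: ge0_le_integral => //=.
- by move=> x _; rewrite lee_fin.
- exact/measurable_EFinP.
- by move=> x _; rewrite lee_fin.
Qed.

End MeasureFacts.

Lemma exists_pushforward d1 d2 (X : measurableType d1) (Y : measurableType d2) (R : realType)
    (mu : {measure set X -> \bar R}) (phi : X -> Y) : measurable_fun setT phi ->
  exists nu : {measure set Y -> \bar R}, (forall A, nu A = mu (phi @^-1` A)) /\
    (forall f : Y -> \bar R, measurable_fun setT f -> (forall y, 0 <= f y)%E ->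
      (\int[nu]_y f y = \int[mu]_x f (phi x))%E).
Proof.
move=> mphi; pose nu : {measure set Y -> \bar R} := pushforward mu phi.
exists (nu mphi); split => // f mf f0.
by apply: (ge0_integral_pushforward mphi mu measurableT mf) => y _; exact: f0.
Qed.

Section FubiniFacts.
Context d1 d2 (T1 : measurableType d1) (T2 : measurableType d2) (R : realType).
Variables (m1 : {sigma_finite_measure set T1 -> \bar R})
  (m2 : {sigma_finite_measure set T2 -> \bar R}).
Local Open Scope ereal_scope.

Lemma measurable_integral_snd (f : T1 * T2 -> \bar R) : measurable_fun setT f ->
  (forall x, 0 <= f x) -> measurable_fun setT (fun x => \int[m2]_y f (x, y)).
Proof. by move=> mf f0; exact: measurable_fun_fubini_tonelli_F. Qed.

Lemma measurable_integral_fst (f : T1 * T2 -> \bar R) : measurable_fun setT f ->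
  (forall x, 0 <= f x) -> measurable_fun setT (fun y => \int[m1]_x f (x, y)).
Proof. by move=> mf f0; exact: measurable_fun_fubini_tonelli_G. Qed.

Lemma integral_swap (f : T1 * T2 -> \bar R) : measurable_fun setT f ->
  (forall x, 0 <= f x) ->
  \int[m1]_x \int[m2]_y f (x, y) = \int[m2]_y \int[m1]_x f (x, y).
Proof. by move=> mf f0; exact: fubini_tonelli. Qed.

Lemma measurable_cut1 d3 (T3 : measurableType d3) (f : T1 * T2 -> T3) x :
  measurable_fun setT f -> measurable_fun setT (fun y => f (x, y)).
Proof. by move=> mf; apply: measurableT_comp => //; exact: pair1_measurable. Qed.

Lemma measurable_cut2 d3 (T3 : measurableType d3) (f : T1 * T2 -> T3) y :
  measurable_fun setT f -> measurable_fun setT (fun x => f (x, y)).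
Proof. by move=> mf; apply: measurableT_comp => //; exact: pair2_measurable. Qed.

End FubiniFacts.

Section TupleFacts.
Context d (T : measurableType d) (R : realType) (n : nat).

Lemma measurable_funtnth (f : T -> n.-tuple R) i :
  measurable_fun setT f -> measurable_fun setT (fun x => tnth (f x) i).
Proof. by move=> mf; apply: (measurableT_comp (measurable_tnth i)). Qed.

Lemma measurable_dotp (f g : T -> n.-tuple R) :
  measurable_fun setT f -> measurable_fun setT g ->
  measurable_fun setT (fun x => dotp (f x) (g x)).
Proof.
move=> mf mg; rewrite /dotp; apply: measurable_sum => i.
by apply: measurable_funM; exact: measurable_funtnth.
Qed.

Lemma measurable_sqdist (f g : T -> n.-tuple R) :
  measurable_fun setT f -> measurable_fun setT g ->
  measurable_fun setT (fun x => sqdist (f x) (g x)).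
Proof.
move=> mf mg; rewrite /sqdist; apply: measurable_sum => i.
by apply: measurable_funX; apply: measurable_funB; exact: measurable_funtnth.
Qed.

Lemma measurable_eqfun (f g : T -> R) :
  measurable_fun setT f -> measurable_fun setT g -> measurable [set x | f x = g x].
Proof.
move=> mf mg.
rewrite (_ : [set x | _] = (fun x => f x - g x) @^-1` [set 0]); last first.
  by apply/seteqP; split => x /= => [->|/eqP]; rewrite ?subrr// subr_eq0 => /eqP.
by rewrite -[X in measurable X]setTI; apply: measurable_funB.
Qed.

Lemma measurable_lefun (f g : T -> R) :
  measurable_fun setT f -> measurable_fun setT g -> measurable [set x | f x <= g x].
Proof.
move=> mf mg.
rewrite (_ : [set x | _] = (fun x => f x - g x) @^-1` `]-oo, 0]); last first.
  by apply/seteqP; split => x /=; rewrite in_itv /= subr_le0.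
by rewrite -[X in measurable X]setTI; apply: measurable_funB.
Qed.

Lemma measurable_ltfun (f g : T -> R) :
  measurable_fun setT f -> measurable_fun setT g -> measurable [set x | f x < g x].
Proof.
move=> mf mg.
rewrite (_ : [set x | _] = (fun x => f x - g x) @^-1` `]-oo, 0[); last first.
  by apply/seteqP; split => x /=; rewrite in_itv /= subr_lt0.
by rewrite -[X in measurable X]setTI; apply: measurable_funB.
Qed.

End TupleFacts.

(** The identity [x^-1 = x * (x^2)^(-1)] reduces inversion to a real power of a nonnegative number;
    at 0 both sides vanish. *)
Lemma measurable_funV d (T : measurableType d) (R : realType) (f : T -> R) :
  measurable_fun setT f -> measurable_fun setT (fun x => (f x)^-1).
Proof.
move=> mf; rewrite (_ : (fun _ => _) = fun x => f x * (f x ^+ 2) `^ (- 1)).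
  apply: measurable_funM => //; apply: (measurableT_comp (measurable_powR _)).
  exact: measurable_funX.
apply/funext => x; rewrite powRN powRr1 ?sqr_ge0//.
have [->|fx] := eqVneq (f x) 0; first by rewrite invr0 mul0r.
by rewrite expr2 invfM mulrA divff// mul1r.
Qed.

Lemma measurable_funsqrt d (T : measurableType d) (R : realType) (f : T -> R) :
  measurable_fun setT f -> measurable_fun setT (fun x => Num.sqrt (f x)).
Proof.
move=> mf; rewrite (_ : (fun _ => _) = fun x => (Num.max 0 (f x)) `^ (2^-1)).
  by apply: (measurableT_comp (measurable_powR _)); exact: measurable_maxr.
apply/funext => x; rewrite powR12_sqrt ?le_max ?lexx//.
by have [fx|fx] := ltP 0 (f x); rewrite // sqrtr0 ler0_sqrtr.
Qed.

Lemma ler_prod_scale (R : numDomainType) (I : Type) (r : seq I) (K : R) (a b : I -> R) :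
  (forall i, 0 <= a i) -> (forall i, a i <= K * b i) ->
  \prod_(i <- r) a i <= K ^+ size r * \prod_(i <- r) b i.
Proof.
move=> a0 ab; elim: r => [|i r IH]; first by rewrite !big_nil mul1r.
by rewrite !big_cons /= exprS mulrACA; apply: ler_pM => //; exact: prodr_ge0.
Qed.

Lemma measurable_sphere (R : realType) n : measurable (sphere : set (n.-tuple R)).
Proof. by apply: (@measurable_eqfun _ _ R) => //; apply: measurable_dotp. Qed.

(** * Inner products on the unit sphere *)

Section DotProduct.
Context {R : realType} {n : nat}.
Implicit Types u v w : n.-tuple R.

Lemma dotpZ r u v : dotp (tscale r u) v = r * dotp u v.
Proof. by rewrite /dotp mulr_sumr; apply: eq_bigr => i _; rewrite tnth_mktuple mulrA. Qed.

Lemma dotpC u v : dotp u v = dotp v u.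
Proof. by apply: eq_bigr => i _; rewrite mulrC. Qed.

Lemma dotpZZ r u : dotp (tscale r u) (tscale r u) = r ^+ 2 * dotp u u.
Proof. by rewrite dotpZ dotpC dotpZ mulrA expr2. Qed.

Lemma coord_sq_le u i : tnth u i ^+ 2 <= dotp u u.
Proof.
rewrite /dotp (bigD1 i)//= -expr2 lerDl; apply: sumr_ge0 => j _.
by rewrite -expr2 sqr_ge0.
Qed.

Lemma coord_norm_le1 u i : dotp u u <= 1 -> `|tnth u i| <= 1.
Proof.
move=> u1; rewrite -(@ler_pXn2r _ 2)// ?nnegrE// expr1n real_normK ?num_real//.
exact: le_trans (coord_sq_le u i) u1.
Qed.

Lemma dotpB u v w : dotp u w - dotp v w = \sum_(i < n) (tnth u i - tnth v i) * tnth w i.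
Proof. by rewrite -sumrB; apply: eq_bigr => i _; rewrite mulrBl. Qed.

Lemma sphere_coord u i : sphere u -> `|tnth u i| <= 1.
Proof. by move=> u1; apply: coord_norm_le1; rewrite u1. Qed.

(** The distance is measured coordinatewise because the neighbourhoods used later are boxes. *)
Lemma dotp_dist_le u v w d : sphere w -> (forall i, `|tnth u i - tnth v i| <= d) ->
  `|dotp u w - dotp v w| <= n%:R * d.
Proof.
move=> w1 uvd; rewrite dotpB; apply: le_trans (ler_norm_sum _ _ _) _.
rewrite -[X in X%:R]card_ord -sumr_const mulr_suml; apply: ler_sum => i _.
rewrite mul1r normrM -[d]mulr1; apply: ler_pM => //; exact: sphere_coord.
Qed.

(** Cauchy-Schwarz for unit vectors, from [2 a b <= a^2 + b^2] in each coordinate. *)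
Lemma sumr_sq_le1 (a b : 'I_n -> R) :
  \sum_i a i ^+ 2 = 1 -> \sum_i b i ^+ 2 = 1 -> \sum_i a i * b i <= 1.
Proof.
move=> a1 b1; have : \sum_i (a i * b i) <= \sum_i (a i ^+ 2 + b i ^+ 2) / 2.
  by apply: ler_sum => i _; have := sqr_ge0 (a i - b i); nra.
by rewrite -mulr_suml big_split/= a1 b1; lra.
Qed.

Lemma sphere_dotp_le1 u v : sphere u -> sphere v -> `|dotp u v| <= 1.
Proof.
move=> u1 v1; rewrite ler_norml lerNl; apply/andP; split; last first.
  by apply: sumr_sq_le1; [rewrite -[RHS]u1|rewrite -[RHS]v1]; apply: eq_bigr.
rewrite /dotp -sumrN; under eq_bigr do rewrite -mulNr.
apply: sumr_sq_le1; [rewrite -[RHS]u1|rewrite -[RHS]v1]; apply: eq_bigr => // i _.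
by rewrite sqrrN.
Qed.

End DotProduct.

(** * Surface measure: finiteness, null sets and caps *)

Section SurfaceMeasure.
Context {R : realType} {n : nat} {lam sig : {measure set (n.-tuple R) -> \bar R}}.
Hypotheses (Hlam : is_lebesgue_n lam) (Hsig : is_surface_measure lam sig).

(** Radial projection to the sphere, meaningful away from the origin; the real power makes
    measurability immediate. *)
Let normalize (x : n.-tuple R) := tscale ((dotp x x) `^ (- 2^-1)) x.

Let measurable_normalize : measurable_fun setT normalize.
Proof.
apply/measurable_fun_tnthP => i; rewrite /normalize.
rewrite (_ : _ \o _ = fun x => dotp x x `^ (- 2^-1) * tnth x i); last first.
  by apply/funext => x /=; rewrite tnth_mktuple.
apply: measurable_funM; last exact: measurable_tnth.
apply: (measurableT_comp (measurable_powR _)); exact: measurable_dotp.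
Qed.

(** Polar coordinates: a point of the punctured unit ball is its norm times its radial projection.
    This form, unlike the existential one, is visibly measurable. *)
Lemma cone_sphereE (A : set (n.-tuple R)) :
  cone (A `&` sphere) = [set x | 0 < dotp x x <= 1] `&` normalize @^-1` A.
Proof.
apply/seteqP; split => [_ [r [u [/andP[r0 r1] [[Au Su] ->]]]]|x [/andP[x0 x1] Ax]] /=.
  have E : dotp (tscale r u) (tscale r u) = r ^+ 2 by rewrite dotpZZ Su mulr1.
  rewrite /normalize E; split; first by rewrite exprn_gt0//= expr_le1// ltW.
  suff -> : tscale ((r ^+ 2) `^ (- 2^-1)) (tscale r u) = u by [].
  rewrite powRN powR12_sqrt ?sqr_ge0// sqrtr_sqr gtr0_norm//.
  apply: eq_from_tnth => i; rewrite !tnth_mktuple mulrA mulVf ?mul1r//.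
  by rewrite gt_eqF.
exists (Num.sqrt (dotp x x)), (normalize x).
have s0 : 0 < Num.sqrt (dotp x x) by rewrite sqrtr_gt0.
have N : (dotp x x) `^ (- 2^-1) = (Num.sqrt (dotp x x))^-1.
  by rewrite powRN powR12_sqrt// ltW.
split; first by rewrite s0 -[leRHS]sqrtr1 ler_sqrt// ltr01.
split; [split => //|].
  rewrite /sphere /= /normalize dotpZZ N exprVn sqr_sqrtr ?(ltW x0)//.
  by rewrite mulVf// gt_eqF.
rewrite /normalize N; apply: eq_from_tnth => i; rewrite !tnth_mktuple mulrA.
by rewrite divff ?mul1r// gt_eqF.
Qed.

Lemma measurable_cone (A : set (n.-tuple R)) :
  measurable A -> measurable (cone (A `&` sphere)).
Proof.
move=> mA; rewrite cone_sphereE; apply: measurableI.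
  have mxx : measurable_fun setT (fun x : n.-tuple R => dotp x x).
    exact: measurable_dotp.
  rewrite (_ : [set _ | _] = [set x | 0 < dotp x x] `&` [set x | dotp x x <= 1]).
    by apply: measurableI; [exact: measurable_ltfun|exact: measurable_lefun].
  by apply/seteqP; split => x /= => [/andP[]|[-> ->]].
by rewrite -[X in measurable X]setTI; exact: measurable_normalize.
Qed.

Let box := [set x : n.-tuple R | forall i, -1 <= tnth x i <= 1].

Lemma measurable_tbox (a b : n.-tuple R) :
  measurable [set x | forall i, tnth a i <= tnth x i <= tnth b i].
Proof.
rewrite (_ : [set _ | _] = \bigcap_(i in [set: 'I_n])
    ([set x : n.-tuple R | tnth a i <= tnth x i] `&` [set x | tnth x i <= tnth b i])).
  apply: fin_bigcap_measurable => // i _.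
  by apply: measurableI; apply: measurable_lefun => //; exact: measurable_tnth.
apply/seteqP; split => x /= H i; first by move=> _; apply/andP; exact: H.
by apply/andP; exact: H.
Qed.

Let lam_box : lam box = (2 ^+ n)%:E.
Proof.
have := Hlam [tuple -1 | i < n] [tuple 1 | i < n].
rewrite (_ : [set x | _] = box).
  move=> ->; congr EFin; rewrite -[X in _ ^+ X]card_ord -prodr_const.
  by apply: eq_bigr => i _; rewrite !tnth_mktuple max_l; lra.
by apply/seteqP; split => x /= H i; have := H i; rewrite !tnth_mktuple.
Qed.

Let measurable_box : measurable box.
Proof.
rewrite (_ : box = [set x | forall i, tnth [tuple (-1 : R) | i < n] i <= tnth x i
   <= tnth [tuple (1 : R) | i < n] i]); first exact: measurable_tbox.
by apply/seteqP; split => x /= H i; have := H i; rewrite !tnth_mktuple.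
Qed.

Let cone_box A : cone (A `&` sphere) `<=` box.
Proof.
rewrite cone_sphereE => x [/andP[_ x1] _] i.
by have := coord_norm_le1 i x1; rewrite ler_norml.
Qed.

(** Every cone lies in the cube [[-1, 1]^n], of volume [2^n]. *)
Lemma surface_le (A : set (n.-tuple R)) : measurable A ->
  (sig A <= (n%:R * 2 ^+ n)%:E)%E.
Proof.
move=> mA; rewrite Hsig// EFinM -lam_box lee_wpmul2l ?lee_fin//.
by apply: le_measure; rewrite ?inE//; exact: measurable_cone.
Qed.

Lemma surface_null (A : set (n.-tuple R)) : measurable A ->
  lam (cone (A `&` sphere)) = 0%E -> sig A = 0%E.
Proof. by move=> mA A0; rewrite Hsig// A0 mule0. Qed.

(** The cone over this set lies in a box whose [i]-th side is degenerate. *)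
Lemma surface_coord0 i : sig [set u | tnth u i = 0] = 0%E.
Proof.
have mA : measurable [set u : n.-tuple R | tnth u i = 0].
  by apply: (@measurable_eqfun _ _ R) => //; exact: measurable_tnth.
apply: surface_null => //; apply/eqP; rewrite -measure_le0.
pose a := [tuple (if j == i then 0 else -1 : R) | j < n].
pose b := [tuple (if j == i then 0 else 1 : R) | j < n].
have <- : lam [set x | forall j, tnth a j <= tnth x j <= tnth b j] = 0%E.
  by rewrite Hlam (bigD1 i)//= !tnth_mktuple eqxx subrr maxxx mul0r.
apply: le_measure; rewrite ?inE; [exact: measurable_cone|exact: measurable_tbox|].
move=> x Cx j; have := cone_box Cx j; rewrite !tnth_mktuple; case: eqP => // -> _.
by move: Cx => [r [u [_ [[/= ui _] ->]]]]; rewrite tnth_mktuple ui mulr0 lexx.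
Qed.

(* The part of the hyperplane [x_i a_j = x_j a_i] in the cube is covered by 2 N boxes of
   volume O(1 / N^2). *)
Lemma lebesgue_hyperplane (i j : 'I_n) (c : R) : i != j -> 0 < c ->
  lam (box `&` [set x | tnth x i = c * tnth x j]) = 0%E.
Proof.
move=> ij c0.
pose H := box `&` [set x | tnth x i = c * tnth x j].
have mH : measurable H.
  apply: measurableI => //; apply: (@measurable_eqfun _ _ R); first exact: measurable_tnth.
  by apply: measurable_funM => //; exact: measurable_tnth.
pose K : R := 2 ^+ n * c * 2.
suff HN (N : nat) : (0 < N)%N -> (lam H <= (K / N%:R)%:E)%E.
  apply/eqP; rewrite -measure_le0; apply/lee_addgt0Pr => e e0; rewrite add0e.
  have K0 : 0 < K by rewrite /K !mulr_gt0// exprn_gt0.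
  pose N := (Num.trunc (K / e)).+1.
  apply: (le_trans (HN N isT)); rewrite lee_fin ler_pdivrMr ?ltr0n//.
  rewrite mulrC -ler_pdivrMr//; apply: ltW.
  exact: truncnS_gt.
move=> N0; have Np : 0 < N%:R :> R by rewrite ltr0n.
pose t (k : nat) : R := -1 + k%:R / N%:R.
pose a k := [tuple (if l == i then c * t k else if l == j then t k else -1) | l < n].
pose b k := [tuple (if l == i then c * t k.+1 else if l == j then t k.+1 else 1) | l < n].
pose B k := [set x : n.-tuple R | forall l, tnth (a k) l <= tnth x l <= tnth (b k) l].
have tS k : t k.+1 - t k = N%:R^-1 by rewrite /t -natr1 mulrDl mul1r; lra.
have lamB k : (lam (B k) <= (2 ^+ n * c / N%:R ^+ 2)%:E)%E.
  rewrite /B Hlam lee_fin (bigD1 i)//= (bigD1 j) 1?eq_sym//= !tnth_mktuple eqxx.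
  rewrite eqxx eq_sym (negbTE ij) -mulrBr tS.
  have iN0 : 0 < (N%:R : R)^-1 by rewrite invr_gt0.
  rewrite !max_l ?(ltW iN0) ?mulr_ge0 ?(ltW c0) ?(ltW iN0)//.
  rewrite mulrA (_ : c / N%:R / N%:R = c / N%:R ^+ 2); last by rewrite expr2 invfM mulrA.
  rewrite mulrC -mulrA ler_wpM2r ?divr_ge0 ?exprn_ge0 ?(ltW c0)//.
  apply: (@le_trans _ _ (\prod_(l < n | (l != i) && (l != j)) 2)).
    apply: ler_prod => l /andP[/negbTE li /negbTE lj]; rewrite !tnth_mktuple li lj.
    by rewrite opprK max_l ?lexx ?andbT; lra.
  rewrite prodr_const ler_weXn2l ?ler1n//.
  by rewrite -[X in (_ <= X)%N]card_ord max_card.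
have cover : H `<=` \big[setU/set0]_(k < 2 * N) B k.
  move=> x [bx xij]; rewrite -(bigcup_mkord (2 * N) B).
  have /andP[x1 x2] := bx j.
  pose y := (tnth x j + 1) * N%:R.
  have y0 : 0 <= y by rewrite mulr_ge0 ?(ltW Np)//; lra.
  have y2 : y <= (2 * N)%:R by rewrite natrM ler_wpM2r ?(ltW Np)//; lra.
  have [k [kN ky]] : exists k, (k < 2 * N)%N /\ k%:R <= y <= k.+1%:R.
    (* The endpoint [x_j = 1] gives [y = 2 N], whose integer part is out of range; it is put in the
       last box. *)
    have [yN|yN] := ltP y (2 * N)%:R.
      have yS : y < (Num.trunc y).+1%:R by exact: truncnS_gt.
      exists (Num.trunc y); split; last by apply/andP; split; [rewrite truncn_le|exact: ltW].
      by rewrite -(ltr_nat R); apply: le_lt_trans yN; rewrite truncn_le.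
    exists (2 * N).-1; have E : (2 * N).-1.+1 = (2 * N)%N by rewrite prednK// muln_gt0.
    rewrite E y2 andbT; split => //.
    by apply: le_trans yN; rewrite ler_nat leq_pred.
  have /andP[k1 k2] := ky.
  have t1 : t k <= tnth x j by rewrite /t -lerBrDl opprK ler_pdivrMr.
  have t2 : tnth x j <= t k.+1 by rewrite /t -lerBlDl opprK ler_pdivlMr.
  exists k => // l; rewrite !tnth_mktuple.
  case: (eqVneq l i) => [->|_]; first by rewrite xij !ler_pM2l// t1 t2.
  by case: (eqVneq l j) => [->|_]; [rewrite t1 t2|exact: bx].
apply: (@le_trans _ _ (lam (\big[setU/set0]_(k < 2 * N) B k))).
  apply: le_measure; rewrite ?inE//; apply: bigsetU_measurable => k _.
  exact: measurable_tbox.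
apply: (@le_trans _ _ (\sum_(k < 2 * N) lam (B k))%E).
  by apply: Boole_inequality => k _; exact: measurable_tbox.
apply: (@le_trans _ _ (\sum_(k < 2 * N) (2 ^+ n * c / N%:R ^+ 2)%:E)%E).
  by apply: lee_sum.
rewrite sumEFin lee_fin sumr_const card_ord -[_ *+ (2 * N)]mulr_natl natrM /K.
by rewrite le_eqVlt; apply/orP; left; apply/eqP; field; rewrite gt_eqF.
Qed.

(** The equation is homogeneous in [u], so it persists on the cone, which then lies in the
    hyperplane of slope [p / q]. *)
Lemma surface_hyperplane (i j : 'I_n) (p q : R) : i != j -> 0 < p -> 0 < q ->
  sig [set u | tnth u i * q = tnth u j * p] = 0%E.
Proof.
move=> ij p0 q0.
have mA : measurable [set u : n.-tuple R | tnth u i * q = tnth u j * p].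
  by apply: (@measurable_eqfun _ _ R); apply: measurable_funM => //; exact: measurable_tnth.
apply: surface_null => //; apply/eqP; rewrite -measure_le0.
rewrite -(lebesgue_hyperplane ij (divr_gt0 p0 q0)).
apply: le_measure; rewrite ?inE; first exact: measurable_cone.
  apply: measurableI => //; apply: (@measurable_eqfun _ _ R); first exact: measurable_tnth.
  by apply: measurable_funM => //; exact: measurable_tnth.
move=> x Cx; split; first exact: cone_box Cx.
move: Cx => [r [u [_ [[/= ui _] ->]]]]; rewrite !tnth_mktuple.
by apply: (mulIf (lt0r_neq0 q0)); rewrite -mulrA ui; field; rewrite gt_eqF.
Qed.

(* The cone over the cap contains the cube of side [d / (10 n)] centered at [m / 2]. *)
Lemma surface_cap (m : n.-tuple R) (d : R) : sphere m -> 0 < d <= 1 ->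
  ((n%:R * (d / (10 * n%:R)) ^+ n)%:E <=
    sig [set u | forall i, (`|tnth u i - tnth m i| <= d)%R])%E.
Proof.
move=> Sm /andP[d0 d1].
have n0 : 0 < n%:R :> R.
  rewrite ltr0n lt0n; apply/eqP => n0; move: Sm; rewrite /sphere/= /dotp.
  by rewrite big1 => [/eqP|i _]; [rewrite eq_sym oner_eq0|have := ltn_ord i; rewrite [X in (_ < X)%N]n0].
have n1 : 1 <= n%:R :> R by rewrite ler1n -(ltr0n R).
have sumc (c : R) : n%:R * c = \sum_(i < n) c by rewrite sumr_const card_ord mulr_natl.
pose e : R := d / (20 * n%:R).
have e0 : 0 < e by rewrite divr_gt0// mulr_gt0.
have ne : n%:R * e = d / 20 by rewrite /e; field; rewrite gt_eqF.
pose a := [tuple tnth m i / 2 - e | i < n]; pose b := [tuple tnth m i / 2 + e | i < n].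
set A := [set u | _].
have mA : measurable A.
  rewrite (_ : A = [set x | forall i, tnth [tuple tnth m i - d | i < n] i <= tnth x i
     <= tnth [tuple tnth m i + d | i < n] i]); first exact: measurable_tbox.
  by apply/seteqP; split => x /= H i; have := H i; rewrite !tnth_mktuple ler_distl.
rewrite (_ : _%:E = n%:R%:E * lam [set x | forall i, (tnth a i <= tnth x i <= tnth b i)%R])%E.
  rewrite Hsig// lee_wpmul2l ?lee_fin//.
  apply: le_measure; rewrite ?inE; [exact: measurable_tbox|exact: measurable_cone|].
  move=> x /= Bx.
  have xe i : `|tnth x i - tnth m i / 2| <= e.
    by have := Bx i; rewrite !tnth_mktuple ler_distl.
  (* Expansion of the squared norm around [m / 2], whose squared norm is 1/4. The linear term is at
     most [n e = d / 20], the quadratic one at most [d / 400], so the norm [r] of [x] is within a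
     small multiple of [d] of 1/2. *)
  have E : dotp x x - 1 / 4 = \sum_i tnth m i * (tnth x i - tnth m i / 2) +
      \sum_i (tnth x i - tnth m i / 2) ^+ 2.
    have -> : 1 / 4 = (\sum_i tnth m i * tnth m i) / 4 :> R.
      by congr (_ / _); rewrite -[LHS]Sm.
    rewrite mulr_suml -sumrB -big_split/=; apply: eq_bigr => i _.
    by field.
  have E1 : `|\sum_i tnth m i * (tnth x i - tnth m i / 2)| <= d / 20.
    rewrite -ne; apply: le_trans (ler_norm_sum _ _ _) _.
    rewrite sumc; apply: ler_sum => l _.
    by rewrite normrM -[leRHS]mul1r; apply: ler_pM => //; exact: sphere_coord.
  have E2 : \sum_i (tnth x i - tnth m i / 2) ^+ 2 <= d / 400.
    have -> : d / 400 = n%:R * (e * (20^-1)) by rewrite mulrA ne; lra.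
    rewrite sumc; apply: ler_sum => l _.
    rewrite -real_normK ?num_real// expr2; apply: ler_pM => //.
    apply: (le_trans (xe l)); rewrite /e ler_pdivrMr ?mulr_gt0//; nra.
  have E3 : 0 <= \sum_i (tnth x i - tnth m i / 2) ^+ 2.
    by apply: sumr_ge0 => l _; exact: sqr_ge0.
  move: E1; rewrite ler_norml => /andP[E1 E1'].
  move: E E1 E1' E2 E3; move: (\sum_i (tnth m i * _)) (\sum_i _ ^+ 2) => s1 s2 E E1 E1' E2 E3.
  pose r := Num.sqrt (dotp x x).
  have xx0 : 0 < dotp x x by lra.
  have r2 : r ^+ 2 = dotp x x by rewrite sqr_sqrtr// ltW.
  have r0 : 0 < r by rewrite sqrtr_gt0.
  have r1 : r <= 1 by nra.
  have r4 : 395 / 1000 <= r by nra.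
  have rd : `|r - 1 / 2| <= 106 / 1000 * d by rewrite ler_norml; apply/andP; split; nra.
  exists r, (tscale r^-1 x); rewrite r0 r1; split => //; split; last first.
    by apply: eq_from_tnth => i; rewrite !tnth_mktuple mulrA divff ?mul1r ?gt_eqF.
  split; last by rewrite /sphere /= dotpZZ exprVn r2 mulVf// gt_eqF.
  move=> i; rewrite tnth_mktuple.
  (* The error of the projected point splits into the offset of [x] from [m / 2] and the error of
     its norm, both magnified by [1 / r], a bounded factor by [r4]. *)
  have -> : r^-1 * tnth x i - tnth m i =
      r^-1 * ((tnth x i - tnth m i / 2) - (r - 1 / 2) * tnth m i).
    by field; rewrite gt_eqF.
  rewrite normrM gtr0_norm ?invr_gt0// mulrC ler_pdivrMr//.
  apply: le_trans (ler_normB _ _) _; rewrite normrM.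
  have := xe i; have := sphere_coord i Sm; have := normr_ge0 (tnth m i).
  have ed : e <= d / 20.
    by rewrite -ne ler_peMl// ltW.
  have := normr_ge0 (r - 1 / 2).
  move: `|tnth m i| `|r - 1 / 2| `|tnth x i - _| rd => M Q P; nra.
rewrite Hlam -EFinM; congr (_ * _)%:E.
rewrite -[X in _ ^+ X]card_ord -prodr_const; apply: eq_bigr => i _.
rewrite !tnth_mktuple (_ : _ - _ = d / (10 * n%:R)) ?max_l//.
  by rewrite divr_ge0 ?mulr_ge0// ltW.
by rewrite /e; field; rewrite gt_eqF.
Qed.

End SurfaceMeasure.

(** * The fractional knapsack: structure of optimal solutions *)

Section LinearProgram.
Context {R : realType} {n : nat}.
Implicit Types (u a x y : n.-tuple R) (b t : R).

(** No objective coefficient vanishes and no two value-to-weight ratios [u_i / a_i] coincide; the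
    ratios are cross-multiplied. *)
Definition generic u a : Prop :=
  (forall i, tnth u i != 0) /\
  (forall i j, i != j -> tnth u i * tnth a j != tnth u j * tnth a i).

(* [None] marks a fractional coordinate. *)
Definition pattern := {ffun 'I_n -> option bool}.

Definition pattern_of x : pattern :=
  [ffun i => if tnth x i == 0 then Some false else if tnth x i == 1 then Some true else None].

(* The clipping to [0, 1] is inactive when [c] is the pattern of an optimal solution. *)
Definition vertex (c : pattern) (ab : n.-tuple R * R) : n.-tuple R :=
  [tuple match c i with
         | Some v => v%:R
         | None => Num.max 0 (Num.min 1
             ((ab.2 - \sum_(j < n) (c j == Some true)%:R * tnth ab.1 j) / tnth ab.1 i))
         end | i < n].

Let bump x i t : n.-tuple R := [tuple tnth x k + (k == i)%:R * t | k < n].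

Let tnth_bump x i t k : tnth (bump x i t) k = if k == i then tnth x k + t else tnth x k.
Proof. by rewrite tnth_mktuple; case: eqP; rewrite ?mul1r ?mul0r ?addr0. Qed.

Let dotp_bump u x i t : dotp u (bump x i t) = dotp u x + tnth u i * t.
Proof.
rewrite /dotp [X in X = _](bigD1 i)//= [X in _ = X + _](bigD1 i)//= tnth_bump eqxx.
rewrite (eq_bigr (fun k => tnth u k * tnth x k)); first by ring.
by move=> k /negbTE ki; rewrite tnth_bump ki.
Qed.

(** If the budget were slack, a fractional coordinate could be moved in the direction of the sign of
    [u_i], improving the objective. *)
Lemma LP_optimal_binding u a b x i : generic u a -> (forall i, 0 < tnth a i) ->
  LP_optimal u a b x -> 0 < tnth x i < 1 -> dotp a x = b.
Proof.
move=> [u0 _] a0 [[axb x01] xopt] /andP[xi0 xi1]; apply/eqP; rewrite eq_le axb/= leNgt.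
apply/negP => axlt.
have bad t : t != 0 -> 0 <= tnth x i + t <= 1 -> tnth a i * t <= b - dotp a x ->
    tnth u i * t <= 0.
  move=> t0 tx ta; have F : LP_feasible a b (bump x i t).
    split; first by rewrite dotp_bump; lra.
    by move=> k; rewrite tnth_bump; case: eqP => [->|_].
  by have := xopt _ F; rewrite dotp_bump; lra.
have [ui|ui] := ltP (tnth u i) 0.
  have := bad (- tnth x i); rewrite oppr_eq0 gt_eqF// subrr lexx ler01.
  have ai := a0 i; suff : tnth a i * - tnth x i <= b - dotp a x by nra.
  by nra.
have uip : 0 < tnth u i by rewrite lt0r u0.
pose t := Num.min (1 - tnth x i) ((b - dotp a x) / tnth a i).
have t0 : 0 < t by rewrite lt_min subr_gt0 xi1 divr_gt0// subr_gt0.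
have t1 : t <= 1 - tnth x i by rewrite ge_min lexx.
have t2 : tnth a i * t <= b - dotp a x.
  by rewrite mulrC -ler_pdivlMr// ge_min lexx orbT.
have tx : 0 <= tnth x i + t <= 1 by apply/andP; split; lra.
by have := bad t (lt0r_neq0 t0) tx t2; nra.
Qed.

(** With two fractional coordinates, moving them by [t a_j] and [- t a_i] preserves the budget and
    changes the objective by [t (u_i a_j - u_j a_i)]. Both signs of [t] are feasible when [|t|] is
    small, so optimality forces a tie of the ratios, which genericity excludes. *)
Lemma LP_optimal_fractional u a b x i j : generic u a -> (forall i, 0 < tnth a i) ->
  LP_optimal u a b x -> 0 < tnth x i < 1 -> 0 < tnth x j < 1 -> i = j.
Proof.
move=> [_ ua] a0 [[axb x01] xopt] /andP[xi0 xi1] /andP[xj0 xj1].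
apply/eqP/negPn/negP => ij; have := ua i j ij; apply/negP; rewrite negbK.
have ai := a0 i; have aj := a0 j.
have tn k t : `|t| <= Num.min (tnth x k) (1 - tnth x k) -> 0 <= tnth x k + t <= 1.
  by rewrite le_min !ler_norml => /andP[/andP[? ?] /andP[? ?]]; apply/andP; split; lra.
pose e := Num.min (Num.min (tnth x i) (1 - tnth x i) / tnth a j)
                  (Num.min (tnth x j) (1 - tnth x j) / tnth a i).
have e0 : 0 < e by rewrite !lt_min !divr_gt0 ?lt_min ?xi0 ?xj0 ?subr_gt0.
have e1 : e * tnth a j <= Num.min (tnth x i) (1 - tnth x i).
  by rewrite -ler_pdivlMr// ge_min lexx.
have e2 : e * tnth a i <= Num.min (tnth x j) (1 - tnth x j).
  by rewrite -ler_pdivlMr// ge_min lexx orbT.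
have bad t : `|t| = e -> t * (tnth u i * tnth a j - tnth u j * tnth a i) <= 0.
  move=> te; pose y := bump (bump x i (t * tnth a j)) j (- (t * tnth a i)).
  have F : LP_feasible a b y.
    split; first by rewrite !dotp_bump; nra.
    move=> k; rewrite tnth_bump; case: eqP => [->|_]; rewrite tnth_bump.
      rewrite eq_sym (negbTE ij); apply: tn.
      by rewrite normrN normrM te gtr0_norm.
    case: eqP => [->|_] //; apply: tn.
    by rewrite normrM te (gtr0_norm aj).
  by have := xopt _ F; rewrite !dotp_bump; nra.
have b1 := bad e (gtr0_norm e0).
have b2 := bad (- e); rewrite normrN gtr0_norm// in b2; have {}b2 := b2 erefl.
rewrite -subr_eq0; move: b1 b2; set D := _ - _ => b1 b2.
by rewrite eq_le; apply/andP; split; nra.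
Qed.

(** The midpoint of two optima is optimal and fractional wherever they differ, hence they differ in
    at most one coordinate. The budget binds at the midpoint, so it binds at both, and the positive
    weight of that coordinate makes them agree there too. *)
Lemma LP_optimal_unique u a b x y : generic u a -> (forall i, 0 < tnth a i) ->
  LP_optimal u a b x -> LP_optimal u a b y -> x = y.
Proof.
move=> ua a0 xo yo; have [[axb x01] xopt] := xo; have [[ayb y01] yopt] := yo.
pose z := [tuple (tnth x i + tnth y i) / 2 | i < n].
have dz v : dotp v z = (dotp v x + dotp v y) / 2.
  rewrite /dotp -big_split/= mulr_suml; apply: eq_bigr => i _.
  by rewrite tnth_mktuple; field.
have zo : LP_optimal u a b z.
  split; first split.
  - by rewrite dz; lra.
  - by move=> i; rewrite tnth_mktuple; have := x01 i; have := y01 i; lra.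
  - by move=> w wF; rewrite dz; have := xopt w wF; have := yopt w wF; lra.
have zf i : tnth x i != tnth y i -> 0 < tnth z i < 1.
  rewrite neq_lt tnth_mktuple => xy.
  by have := x01 i; have := y01 i; case/orP: xy => xy; lra.
apply: eq_from_tnth => i; apply/eqP/negPn/negP => xyi.
have ab := LP_optimal_binding ua a0 zo (zf i xyi).
have : dotp a x - dotp a y = 0 by move: ab; rewrite dz; lra.
rewrite /dotp -sumrB (bigD1 i)//= big1 => [|j ji]; last first.
  rewrite -mulrBr; apply/eqP; rewrite mulf_eq0 subr_eq0; apply/orP; right.
  apply/negPn/negP => xyj; move/eqP: ji; apply.
  exact: (LP_optimal_fractional ua a0 zo (zf j xyj) (zf i xyi)).
by rewrite addr0 -mulrBr => /eqP; rewrite mulf_eq0 subr_eq0 (negbTE xyi) gt_eqF.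
Qed.

(** There is at most one fractional coordinate, and the binding budget constraint solves for it. *)
Lemma LP_optimal_vertex u ab x : generic u ab.1 -> (forall i, 0 < tnth ab.1 i) ->
  LP_optimal u ab.1 ab.2 x -> vertex (pattern_of x) ab = x.
Proof.
move=> ua a0 xo; have [[axb x01] xopt] := xo.
apply: eq_from_tnth => i; rewrite tnth_mktuple ffunE.
case: (eqVneq (tnth x i) 0) => [->//|xi0]; case: (eqVneq (tnth x i) 1) => [->//|xi1].
have xi : 0 < tnth x i < 1.
  by have := x01 i; rewrite !lt_neqAle xi1 eq_sym xi0 => /andP[-> ->].
suff -> : (ab.2 - \sum_(j < n) (pattern_of x j == Some true)%:R * tnth ab.1 j) / tnth ab.1 i
    = tnth x i.
  by case/andP: xi => ? ?; rewrite (min_r (ltW _))// max_r// ltW.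
rewrite -(LP_optimal_binding ua a0 xo xi) /dotp -sumrB (bigD1 i)//= big1 => [|j ji].
  rewrite ffunE (negbTE xi0) (negbTE xi1) mul0r subr0 addr0.
  by rewrite mulrC mulKf// gt_eqF.
rewrite ffunE; case: (eqVneq (tnth x j) 0) => [->|xj0]; first by rewrite mulr0 mul0r subrr.
case: (eqVneq (tnth x j) 1) => [->|xj1]; first by rewrite mulr1 mul1r subrr.
have xj : 0 < tnth x j < 1.
  by have := x01 j; rewrite !lt_neqAle xj1 eq_sym xj0 => /andP[-> ->].
by rewrite (LP_optimal_fractional ua a0 xo xj xi) eqxx in ji.
Qed.

Lemma vertex_cube c ab i : 0 <= tnth (vertex c ab) i <= 1.
Proof.
rewrite tnth_mktuple; case: (c i) => [[]|]; rewrite ?lexx ?ler01//.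
by rewrite le_max lexx/= ge_max ler01/= ge_min lexx.
Qed.

Lemma vertex_sqdist c c' ab : sqdist (vertex c ab) (vertex c' ab) <= n%:R.
Proof.
rewrite -[X in X%:R]card_ord -sumr_const; apply: ler_sum => i _.
have := vertex_cube c ab i; have := vertex_cube c' ab i.
move: (tnth _ i) (tnth _ i) => p q /andP[? ?] /andP[? ?]; nra.
Qed.

Lemma measurable_vertex c : measurable_fun setT (vertex c).
Proof.
apply/measurable_fun_tnthP => i.
rewrite (_ : _ \o _ = fun ab => match c i with Some v => v%:R | None => Num.max 0 (Num.min 1
  ((ab.2 - \sum_(j < n) (c j == Some true)%:R * tnth ab.1 j) / tnth ab.1 i)) end); last first.
  by apply/funext => x /=; rewrite tnth_mktuple.
case: (c i) => [v|]; first exact: measurable_cst.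
apply: measurable_maxr => //; apply: measurable_minr => //; apply: measurable_funM.
  apply: measurable_funB => //; apply: measurable_sum => j; apply: measurable_funM => //.
  exact: measurable_funtnth.
apply: measurable_funV; exact: measurable_funtnth.
Qed.

Lemma measurable_pattern_eq d (T : measurableType d) (f : T -> n.-tuple R) c :
  measurable_fun setT f -> measurable [set x | pattern_of (f x) = c].
Proof.
move=> mf.
rewrite (_ : [set _ | _] = \bigcap_(i in [set: 'I_n]) [set x | pattern_of (f x) i = c i]).
  apply: fin_bigcap_measurable => // i _.
  have m0 : measurable [set x | tnth (f x) i = 0].
    by apply: (@measurable_eqfun _ _ R) => //; exact: measurable_funtnth.
  have m1 : measurable [set x | tnth (f x) i = 1].
    by apply: (@measurable_eqfun _ _ R) => //; exact: measurable_funtnth.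
  case E : (c i) => [[]|].
  - rewrite (_ : [set _ | _] = [set x | tnth (f x) i = 1])//.
    apply/seteqP; split => x /=; rewrite ffunE; last by move=> ->; rewrite oner_eq0 eqxx.
    by case: eqP => // _; case: eqP.
  - rewrite (_ : [set _ | _] = [set x | tnth (f x) i = 0])//.
    apply/seteqP; split => x /=; rewrite ffunE; last by move=> ->; rewrite eqxx.
    by case: eqP => // _; case: eqP.
  - rewrite (_ : [set _ | _] = ~` ([set x | tnth (f x) i = 0] `|` [set x | tnth (f x) i = 1])).
      by apply: measurableC; exact: measurableU.
    apply/seteqP; split => x /=; rewrite ffunE.
      by case: eqP => // ?; case: eqP => // ? _ [].
    by move=> /not_orP[]; case: eqP => // _ _; case: eqP.
apply/seteqP; split => x /= H; [by move=> i _ /=; rewrite H|apply/ffunP => i; exact: H].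
Qed.

End LinearProgram.

(** * The law of an observation as a mixture over finitely many patterns *)

Section Law.
Context {R : realType} {n : nat}.
Local Notation vec := (n.-tuple R).
Context {s : {finite_measure set vec -> \bar R}} {Pab : probability (vec * R)%type R}
  {xs : vec -> vec * R -> vec}.
Hypothesis s_gt0 : (0 < s sphere)%E.

(** Extending the density by 0 off the sphere turns integrals over [sphere] into integrals over the
    whole space, jointly measurable in parameter and point. *)
Definition dens (th : param) (u : vec) : R := \1_sphere u * vmf_density s th u.

Lemma vmf_norm_ge0 th : 0 <= vmf_norm s th.
Proof. by apply: fine_ge0; apply: integral_ge0 => u _; rewrite lee_fin expR_ge0. Qed.

Lemma dens_ge0 th u : 0 <= dens th u.
Proof. by rewrite mulr_ge0// divr_ge0 ?expR_ge0// vmf_norm_ge0. Qed.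

Lemma measurable_exponent : measurable_fun setT
  (fun p : (vec * R) * vec => expR (- p.1.2 * dotp p.1.1 p.2)).
Proof.
apply: (measurableT_comp (f := expR)) => //; apply: measurable_funM.
  apply: measurable_funN; exact: (measurableT_comp measurable_snd measurable_fst).
by apply: measurable_dotp => //; exact: (measurableT_comp measurable_fst measurable_fst).
Qed.

Let kernelE th : (\int[s]_(v in sphere) (expR (- th.2 * dotp th.1 v))%:E =
  \int[s]_v (expR (- th.2 * dotp th.1 v) * \1_sphere v)%:E)%E.
Proof.
rewrite integral_mkcond; apply: eq_integral => v _; rewrite patchE indicE.
by case: ifPn => _; rewrite ?mulr1 ?mulr0.
Qed.

Lemma measurable_vmf_norm : measurable_fun setT (@vmf_norm R n s).
Proof.
apply: (measurableT_comp (f := fine)) => //.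
under eq_fun do rewrite kernelE.
pose f (p : (vec * R) * vec) := (expR (- p.1.2 * dotp p.1.1 p.2) * \1_sphere p.2)%:E.
apply: (@measurable_integral_snd _ _ _ _ _ _ f) => [|x].
  apply/measurable_EFinP; apply: measurable_funM; first exact: measurable_exponent.
  apply: (measurableT_comp _ measurable_snd); apply: measurable_indic.
  exact: measurable_sphere.
by rewrite lee_fin mulr_ge0// expR_ge0.
Qed.

Lemma measurable_dens : measurable_fun setT (fun p : (vec * R) * vec => dens p.1 p.2).
Proof.
apply: measurable_funM.
  apply: (measurableT_comp _ measurable_snd); apply: measurable_indic.
  exact: measurable_sphere.
apply: measurable_funM; first exact: measurable_exponent.
apply: measurable_funV; exact: (measurableT_comp measurable_vmf_norm measurable_fst).
Qed.

Lemma measurable_dens_cut th : measurable_fun setT (dens th).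
Proof. exact: (measurable_cut1 th measurable_dens). Qed.

Let measurable_kernel (th : (vec * R)) : measurable_fun setT
  (fun v => expR (- th.2 * dotp th.1 v) * \1_sphere v).
Proof.
apply: measurable_funM.
  exact: (measurable_cut1 th measurable_exponent).
by apply: measurable_indic; exact: measurable_sphere.
Qed.

(** The kernel is at most [exp |kappa|] on the sphere and the measure is finite, so [fine] loses
    nothing. *)
Lemma vmf_normE (th : (vec * R)) : sphere th.1 ->
  (vmf_norm s th)%:E = (\int[s]_v (expR (- th.2 * dotp th.1 v) * \1_sphere v)%:E)%E.
Proof.
move=> Sth; rewrite /vmf_norm kernelE fineK// ge0_fin_numE; last first.
  by apply: integral_ge0 => v _; rewrite lee_fin mulr_ge0 ?expR_ge0.
apply: (@le_lt_trans _ _ ((expR `|th.2|)%:E * s setT)%E).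
  apply: ge0_integral_le_measure.
  - exact: (measurable_kernel th).
  - by move=> v; rewrite mulr_ge0 ?expR_ge0.
  - move=> v; rewrite indicE; case: (boolP (v \in _)) => [/[!inE] Sv|_]; last first.
      by rewrite mulr0 expR_ge0.
    rewrite mulr1 ler_expR; apply: le_trans (ler_norm _) _.
    by rewrite normrM normrN ler_piMr// sphere_dotp_le1.
by rewrite lte_mul_pinfty ?lee_fin ?expR_ge0// ltey_eq fin_num_measure.
Qed.

Lemma vmf_norm_gt0 (th : (vec * R)) : sphere th.1 -> 0 < vmf_norm s th.
Proof.
move=> Sth; rewrite -lte_fin vmf_normE//.
apply: (@lt_le_trans _ _ ((expR (- `|th.2|))%:E * s sphere)%E).
  by rewrite mule_gt0// lte_fin expR_gt0.
have -> : s sphere = (\int[s]_v (\1_sphere v)%:E)%E.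
  by rewrite integral_indic ?setIT//; exact: measurable_sphere.
rewrite -integral_EFinZl ?expR_ge0//; last by apply: measurable_indic; exact: measurable_sphere.
apply: le_lower_integral => v _; first by rewrite lee_fin mulr_ge0 ?expR_ge0.
rewrite lee_fin indicE; case: (boolP (v \in _)) => [/[!inE] Sv|_]; last by rewrite !mulr0.
rewrite !mulr1 ler_expR lerNl; apply: le_trans (ler_norm _) _.
by rewrite normrN normrM normrN ler_piMr// sphere_dotp_le1.
Qed.

Lemma integral_dens (th : (vec * R)) : sphere th.1 -> (\int[s]_u (dens th u)%:E = 1)%E.
Proof.
move=> Sth; have Z0 := vmf_norm_gt0 Sth.
under eq_integral => u _.
  rewrite (_ : dens th u = (vmf_norm s th)^-1 * (expR (- th.2 * dotp th.1 u) * \1_sphere u)).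
    over.
  by rewrite /dens /vmf_density; ring.
rewrite integral_EFinZl ?invr_ge0 ?(ltW Z0)//.
by rewrite -vmf_normE// -EFinM mulVf// gt_eqF.
Qed.

Local Notation patset c ab := [set u | pattern_of (xs u ab) = c].

(** The conditional probability, given [(a, b)], that the solution has pattern [c]. *)
Definition pr (th : param) (c : pattern) (ab : vec * R) : R :=
  fine (\int[s]_u (dens th u * \1_(patset c ab) u)%:E).

Lemma pr_ge0 th c ab : 0 <= pr th c ab.
Proof. by apply: fine_ge0; apply: integral_ge0 => u _; rewrite lee_fin mulr_ge0// dens_ge0. Qed.

Hypothesis mxs : measurable_fun setT (fun p : vec * (vec * R) => xs p.1 p.2).

Let measurable_xs ab : measurable_fun setT (fun u => xs u ab).
Proof. exact: (measurable_cut2 ab mxs). Qed.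

Let measurable_patset c ab : measurable (patset c ab).
Proof. exact: measurable_pattern_eq. Qed.

Let measurable_pr_integrand th c ab :
  measurable_fun setT (fun u => dens th u * \1_(patset c ab) u).
Proof.
by apply: measurable_funM; [exact: measurable_dens_cut|exact: measurable_indic].
Qed.

Lemma prE th c ab : sphere th.1 ->
  (pr th c ab)%:E = (\int[s]_u (dens th u * \1_(patset c ab) u)%:E)%E.
Proof.
move=> Sth; rewrite fineK// ge0_fin_numE; last first.
  by apply: integral_ge0 => u _; rewrite lee_fin mulr_ge0// dens_ge0.
apply: (@le_lt_trans _ _ 1%E); last exact: ltry.
rewrite -(integral_dens Sth); apply: le_lower_integral => u _.
  by rewrite lee_fin mulr_ge0// dens_ge0.
by rewrite lee_fin ler_piMr ?dens_ge0// indicE lern1 leq_b1.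
Qed.

Lemma measurable_pr c : measurable_fun setT (fun p : (vec * R) * (vec * R) => pr p.1 c p.2).
Proof.
apply: (measurableT_comp (f := fine)) => //.
pose A := [set q : ((vec * R) * (vec * R)) * vec | pattern_of (xs q.2 q.1.2) = c].
pose f (q : ((vec * R) * (vec * R)) * vec) := (dens q.1.1 q.2 * \1_A q)%:E.
rewrite (_ : (fun _ => _) = fun p => (\int[s]_u f (p, u))%E); last first.
  by apply/funext => p; apply: eq_integral => u _; rewrite /f !indicE.
apply: measurable_integral_snd => [|q]; last by rewrite lee_fin mulr_ge0// dens_ge0.
apply/measurable_EFinP; apply: measurable_funM.
  apply: (measurableT_comp measurable_dens (g := fun q : ((vec * R) * (vec * R)) * vec => (q.1.1, q.2))).
  apply: measurable_fun_pair => //.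
  exact: (measurableT_comp measurable_fst measurable_fst).
apply: measurable_indic; apply: measurable_pattern_eq.
apply: (measurableT_comp mxs (g := fun q : ((vec * R) * (vec * R)) * vec => (q.2, q.1.2))).
apply: measurable_fun_pair => //.
exact: (measurableT_comp measurable_snd measurable_fst).
Qed.

(* The weights [K c] are extended reals: [0 * +oo = 0] covers the patterns of probability 0. *)
Lemma integral_pattern (K : pattern -> \bar R) th ab : sphere th.1 ->
  (forall c, (0 <= K c)%E) ->
  (\int[s]_u (K (pattern_of (xs u ab)) * (dens th u)%:E) = \sum_c K c * (pr th c ab)%:E)%E.
Proof.
move=> Sth K0; under [RHS]eq_bigr do rewrite prE//.
under [RHS]eq_bigr => c _.
  rewrite -ge0_integralZl//; last 2 first.
  - by apply/measurable_EFinP; exact: measurable_pr_integrand.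
  - by move=> u _; rewrite lee_fin mulr_ge0// dens_ge0.
  over.
rewrite -ge0_integral_sum//; last 2 first.
- move=> c; apply: measurable_funeM; apply/measurable_EFinP.
  exact: measurable_pr_integrand.
- by move=> c u _; rewrite mule_ge0// lee_fin mulr_ge0// dens_ge0.
apply: eq_integral => u _; rewrite (bigD1 (pattern_of (xs u ab)))//= big1 => [|c].
  by rewrite indicE mem_set// mulr1 adde0.
by move=> /eqP uc; rewrite indicE memNset ?mulr0 ?mule0// => /esym.
Qed.

Lemma sum_pr th ab : sphere th.1 -> \sum_c pr th c ab = 1.
Proof.
move=> Sth; apply: EFin_inj; rewrite -sumEFin -(integral_dens Sth).
under eq_bigr do rewrite -[_%:E]mul1e.
by rewrite -(integral_pattern (K := fun=> 1%E))//; under eq_integral do rewrite mul1e.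
Qed.

Definition admissible (ab : vec * R) := (forall i, 0 < tnth ab.1 i) /\ 0 <= ab.2.

Hypothesis admissible_ae : {ae Pab, forall ab, admissible ab}.
Hypothesis nongeneric_null : forall a, (forall i, 0 < tnth a i) ->
  {ae s, forall u, generic u a}.
Hypothesis xs_opt : forall u ab, admissible ab -> LP_optimal u ab.1 ab.2 (xs u ab).

Lemma measurable_generic : measurable [set p : vec * (vec * R) | generic p.1 p.2.1].
Proof.
have mt i : measurable_fun setT (fun p : vec * (vec * R) => tnth p.1 i).
  exact: measurable_funtnth.
have ma i : measurable_fun setT (fun p : vec * (vec * R) => tnth p.2.1 i).
  by apply: measurable_funtnth; exact: (measurableT_comp measurable_fst measurable_snd).
rewrite (_ : [set _ | _] =
  (\bigcap_(i in [set: 'I_n]) ~` [set p : vec * (vec * R) | tnth p.1 i = 0]) `&`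
  \bigcap_(ij in [set ij : 'I_n * 'I_n | ij.1 != ij.2])
    ~` [set p | tnth p.1 ij.1 * tnth p.2.1 ij.2 = tnth p.1 ij.2 * tnth p.2.1 ij.1]).
  apply: measurableI.
    apply: fin_bigcap_measurable => // i _; apply: measurableC.
    exact: (@measurable_eqfun _ _ R).
  apply: fin_bigcap_measurable => // ij _; apply: measurableC.
  by apply: (@measurable_eqfun _ _ R); exact: measurable_funM.
apply/seteqP; split => p /= [g1 g2]; split.
- by move=> i _ /eqP; rewrite (negbTE (g1 i)).
- by move=> [i j] /= ij /eqP; rewrite (negbTE (g2 i j ij)).
- by move=> i; apply/eqP; exact: g1.
- by move=> i j ij; apply/eqP; exact: (g2 (i, j)).
Qed.

Lemma measurable_admissible : measurable [set p : vec * (vec * R) | admissible p.2].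
Proof.
rewrite (_ : [set _ | _] =
  (\bigcap_(i in [set: 'I_n]) [set p : vec * (vec * R) | 0 < tnth p.2.1 i]) `&`
  [set p | 0 <= p.2.2]).
  apply: measurableI; last first.
    apply: measurable_lefun => //; exact: (measurableT_comp measurable_snd measurable_snd).
  apply: fin_bigcap_measurable => // i _; apply: measurable_ltfun => //.
  by apply: measurable_funtnth; exact: (measurableT_comp measurable_fst measurable_snd).
by apply/seteqP; split => p /= [H1 H2]; split => // i; [move=> _|]; exact: H1.
Qed.

Lemma vertex_xs u ab : generic u ab.1 -> admissible ab ->
  vertex (pattern_of (xs u ab)) ab = xs u ab.
Proof. by move=> ua adm; apply: (LP_optimal_vertex ua adm.1); exact: xs_opt. Qed.

(** The set of nongeneric [u] depends on [a], so it can be discarded only with [(a, b)] fixed: the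
    integrals are exchanged, and then the integrand in [u] depends almost everywhere on the pattern
    alone. *)
Let integral_swap_admissible (phi : vec * (vec * R) -> \bar R) (K : pattern -> vec * R -> \bar R) th :
  sphere th.1 -> measurable_fun setT phi -> (forall p, 0 <= phi p)%E ->
  (forall c ab, 0 <= K c ab)%E -> (forall c, measurable_fun setT (K c)) ->
  (forall u ab, sphere u -> generic u ab.1 -> admissible ab ->
    phi (u, ab) = K (pattern_of (xs u ab)) ab) ->
  (\int[s]_u ((\int[Pab]_ab phi (u, ab)) * (dens th u)%:E) =
   \int[Pab]_ab \sum_c K c ab * (pr th c ab)%:E)%E.
Proof.
move=> Sth mphi phi0 K0 mK phiK.
pose f p : \bar R := (phi p * (dens th p.1)%:E)%E.
have mf : measurable_fun setT f.
  apply: emeasurable_funM => //; apply/measurable_EFinP.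
  by apply: (measurableT_comp (measurable_dens_cut th)).
have f0 p : (0 <= f p)%E by rewrite mule_ge0// lee_fin dens_ge0.
transitivity (\int[s]_u \int[Pab]_ab f (u, ab))%E.
  apply: eq_integral => u _; rewrite /f /= ge0_integralZr//.
  - exact: (measurable_cut1 u mphi).
  - by rewrite lee_fin dens_ge0.
rewrite integral_swap//; apply: ge0_ae_eq_integral => //.
- exact: measurable_integral_fst.
- apply: emeasurable_sum => c; apply: emeasurable_funM => //; apply/measurable_EFinP.
  exact: (measurable_cut1 th (measurable_pr c)).
- by move=> ab _; apply: integral_ge0.
- by move=> ab _; apply: sume_ge0 => c _; rewrite mule_ge0// lee_fin pr_ge0.
apply: filterS admissible_ae => ab adm _ /=.
rewrite -(integral_pattern (K := fun c => K c ab))//.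
apply: ge0_ae_eq_integral => //.
- exact: (measurable_cut2 ab mf).
- apply: emeasurable_funM; last by apply/measurable_EFinP; exact: measurable_dens_cut.
  rewrite (_ : (fun _ => _) = fun u => (\sum_c K c ab * (\1_(patset c ab) u)%:E)%E).
    apply: emeasurable_sum => c; apply: measurable_funeM; apply/measurable_EFinP.
    exact: measurable_indic.
  apply/funext => u; rewrite (bigD1 (pattern_of (xs u ab)))//= big1 => [|c].
    by rewrite indicE mem_set// mule1 adde0.
  by move=> /eqP uc; rewrite indicE memNset ?mule0// => /esym.
- by move=> u _; rewrite mule_ge0// lee_fin dens_ge0.
apply: filterS (nongeneric_null adm.1) => u ua _ /=.
rewrite /f /= /dens indicE; case: (boolP (u \in _)) => [/[!inE] Su|_]; last first.
  by rewrite mul0r !mule0.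
by rewrite phiK.
Qed.

Lemma law_int_dens th h : law_int s Pab xs th h =
  (\int[s]_u ((\int[Pab]_ab h (xs u ab, ab)) * (dens th u)%:E))%E.
Proof.
rewrite /law_int integral_mkcond; apply: eq_integral => u _; rewrite patchE /dens indicE.
by case: ifPn => _; rewrite ?mul1r ?mul0r ?mule0.
Qed.

Let measurable_at_vertex (h : vec * (vec * R) -> \bar R) c : measurable_fun setT h ->
  measurable_fun setT (fun ab => h (vertex c ab, ab)).
Proof.
move=> mh; apply: (measurableT_comp mh).
by apply: measurable_fun_pair => //; exact: measurable_vertex.
Qed.

Let measurable_at_xs (h : vec * (vec * R) -> \bar R) : measurable_fun setT h ->
  measurable_fun setT (fun p : vec * (vec * R) => h (xs p.1 p.2, p.2)).
Proof.
move=> mh; apply: (measurableT_comp mh).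
by apply: measurable_fun_pair.
Qed.

(** Given [(a, b)], the solution takes the value [vertex c] with probability [pr th c]: the
    dependence on [u] disappears. *)
Lemma law_intE th (h : vec * (vec * R) -> \bar R) : sphere th.1 -> measurable_fun setT h ->
  (forall z, 0 <= h z)%E ->
  law_int s Pab xs th h =
  (\int[Pab]_ab \sum_c h (vertex c ab, ab) * (pr th c ab)%:E)%E.
Proof.
move=> Sth mh h0; rewrite law_int_dens.
pose phi (p : vec * (vec * R)) := h (xs p.1 p.2, p.2).
have mphi : measurable_fun setT phi by exact: measurable_at_xs.
pose K c ab := h (vertex c ab, ab).
have mK c : measurable_fun setT (K c) by exact: (@measurable_at_vertex h c mh).
rewrite -(@integral_swap_admissible phi K)//.
- by move=> p; exact: h0.
- by move=> c ab; exact: h0.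
- by move=> u ab _ ua adm; rewrite /phi /K vertex_xs.
Qed.

(** The observations that carry the law under [th]: produced by a generic objective, and with a
    pattern of positive probability, so that likelihood ratios against [th] make sense. *)
Definition good_obs (th : vec * R) (z : vec * (vec * R)) : Prop :=
  exists u, [/\ sphere u, generic u z.2.1, admissible z.2, z.1 = xs u z.2 &
                0 < pr th (pattern_of z.1) z.2].

(** Here [g] may be nonmeasurable and the comparison is known only on good observations. Multiplying
    [k] by the indicator of the measurable set [B] of draws that produce good observations leaves
    its integral unchanged, by the exchange above and because patterns of probability 0 have weight
    0; the product is below [g] everywhere, and monotonicity of lower integrals concludes. *)
Lemma le_law_int th (k g : vec * (vec * R) -> \bar R) : sphere th.1 -> measurable_fun setT k ->
  (forall z, 0 <= k z)%E -> (forall z, 0 <= g z)%E ->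
  (forall z, good_obs th z -> (k z <= g z)%E) ->
  (law_int s Pab xs th k <= law_int s Pab xs th g)%E.
Proof.
move=> Sth mk k0 g0 kg.
pose A c := [set ab | 0 < pr th c ab].
have mA c : measurable (A c).
  by apply: measurable_ltfun => //; exact: (measurable_cut1 th (measurable_pr c)).
pose B := [set p : vec * (vec * R) | generic p.1 p.2.1] `&` [set p | admissible p.2] `&`
  (\bigcup_(c in [set: pattern]) ([set p | pattern_of (xs p.1 p.2) = c] `&` snd @^-1` A c)) `&`
  [set p | sphere p.1].
have mB : measurable B.
  apply: measurableI; last first.
    by rewrite -[X in measurable X]setTI; apply: measurable_fst => //; exact: measurable_sphere.
  apply: measurableI.
    by apply: measurableI; [exact: measurable_generic|exact: measurable_admissible].
  apply: fin_bigcup_measurable => [|c _]; first exact: finite_finset.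
  apply: measurableI.
    exact: measurable_pattern_eq.
  by rewrite -[X in measurable X]setTI; exact: measurable_snd.
pose phi (p : vec * (vec * R)) := (k (xs p.1 p.2, p.2) * (\1_B p)%:E)%E.
have phi0 p : (0 <= phi p)%E by rewrite mule_ge0// lee_fin.
have mphi : measurable_fun setT phi.
  apply: emeasurable_funM; first exact: measurable_at_xs.
  by apply/measurable_EFinP; exact: measurable_indic.
rewrite law_intE//.
pose K c ab := (k (vertex c ab, ab) * (\1_(A c) ab)%:E)%E.
rewrite (_ : (fun ab => _) = fun ab => (\sum_c K c ab * (pr th c ab)%:E)%E); last first.
  apply/funext => ab; apply: eq_bigr => c _; rewrite /K indicE.
  case: (boolP (ab \in _)) => [_|/negP]; first by rewrite mule1.
  rewrite inE /A/= => /negP; rewrite -leNgt => pr0.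
  by have -> : pr th c ab = 0; [apply/eqP; rewrite eq_le pr0 pr_ge0|rewrite !mule0].
rewrite -(integral_swap_admissible (phi := phi))//; first last.
- move=> u ab Su ua adm; rewrite /phi /K vertex_xs//; congr (_ * _)%E; congr EFin.
  rewrite !indicE; congr (_%:R); congr nat_of_bool; apply/idP/idP; rewrite !inE.
    by move=> [[_ [c _ [/= <-]]]].
  by move=> H; split=> //; split => //; exists (pattern_of (xs u ab)).
- move=> c; apply: emeasurable_funM; first exact: (measurable_at_vertex c mk).
  by apply/measurable_EFinP; exact: measurable_indic.
- by move=> c ab; rewrite mule_ge0// lee_fin.
rewrite law_int_dens; apply: le_lower_integral => u _.
  by rewrite mule_ge0 ?lee_fin ?dens_ge0// integral_ge0.
rewrite lee_wpmul2r ?lee_fin ?dens_ge0//; apply: le_lower_integral => // ab _.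
rewrite /phi indicE; case: (boolP (_ \in B)) => [/[!inE] Bz|_]; last by rewrite mule0.
rewrite mule1; apply: kg; exists u.
by move: Bz => [[[ua adm] [c _ [/= <-]]] Su].
Qed.

Lemma likelihood_factor th0 th z : sphere th.1 -> good_obs th0 z ->
  fine (\int[s]_(u in Uset z) (vmf_density s th u)%:E) = pr th (pattern_of z.1) z.2.
Proof.
move=> Sth [u0 [Su0 gu0 adm zE _]]; congr fine.
set c := pattern_of z.1; set ab := z.2.
have [N [mN N0 sN]] := nongeneric_null adm.1.
have gen u : ~ N u -> generic u ab.1 by move=> Nu; apply: contrapT => ug; exact/Nu/sN.
have eqv u : ~ N u -> sphere u -> (Uset z u <-> pattern_of (xs u ab) = c).
  move=> /gen ug Su; split => [[_ zopt]|pc].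
    by congr pattern_of; apply: (LP_optimal_unique ug adm.1 _ zopt); exact: xs_opt.
  split => //; suff -> : z.1 = xs u z.2 by exact: xs_opt.
  by rewrite -(vertex_xs ug adm) pc /c zE -/ab vertex_xs.
rewrite integral_mkcond.
have d0 u : sphere u -> dens th u = vmf_density s th u.
  by move=> Su; rewrite /dens indicE mem_set// mul1r.
have dv u : 0 <= vmf_density s th u by rewrite divr_ge0 ?expR_ge0 ?vmf_norm_ge0.
have ae_int (f : vec -> \bar R) : measurable_fun setT f -> (forall u, 0 <= f u)%E ->
    (forall u, ~ N u -> f u = (dens th u * \1_(patset c ab) u)%:E) ->
    (\int[s]_u f u = \int[s]_u (dens th u * \1_(patset c ab) u)%:E)%E.
  move=> mf f0 fE; apply: ge0_ae_eq_integral => //.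
  - by apply/measurable_EFinP; exact: measurable_pr_integrand.
  - by move=> u _; rewrite lee_fin mulr_ge0// dens_ge0.
  - exists N; split => // u /= /not_implyP [_ fu]; apply: contrapT => /fE; exact: fu.
apply/eqP; rewrite eq_le; apply/andP; split.
  pose f u := (dens th u * \1_(patset c ab `|` N) u)%:E.
  rewrite -(ae_int f); first last.
  - move=> u Nu; rewrite /f; congr (_ * _)%:E; rewrite !indicE; congr (_%:R).
    by congr nat_of_bool; apply/idP/idP; rewrite !inE; [case|left].
  - by move=> u; rewrite lee_fin mulr_ge0// dens_ge0.
  - apply/measurable_EFinP; apply: measurable_funM; first exact: measurable_dens_cut.
    by apply: measurable_indic; exact: measurableU.
  apply: le_lower_integral => u _; first by rewrite patchE; case: ifP => _; rewrite ?lee_fin.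
  rewrite patchE; case: ifPn => [/[!inE] Uz|_]; last by rewrite lee_fin mulr_ge0// dens_ge0.
  have Su : sphere u by case: Uz.
  rewrite /f lee_fin d0// indicE mem_set ?mulr1//=.
  by have [Nu|Nu] := pselect (N u); [right|left; exact/eqv].
pose f u := (dens th u * \1_(patset c ab `\` N) u)%:E.
rewrite -(ae_int f); first last.
- move=> u Nu; rewrite /f; congr (_ * _)%:E; rewrite !indicE; congr (_%:R).
  by congr nat_of_bool; apply/idP/idP; rewrite !inE; [case|split].
- by move=> u; rewrite lee_fin mulr_ge0// dens_ge0.
- apply/measurable_EFinP; apply: measurable_funM; first exact: measurable_dens_cut.
  by apply: measurable_indic; exact: measurableD.
apply: le_lower_integral => u _; first by rewrite lee_fin mulr_ge0// dens_ge0.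
rewrite /f patchE; case: ifPn => [/[!inE] Uz|/negP]; rewrite ?inE.
  have Su : sphere u by case: Uz.
  by rewrite lee_fin d0// ler_piMr// indicE lern1 leq_b1.
move=> nU; rewrite lee_fin /dens !indicE.
case: (boolP (u \in sphere)) => [/[!inE] Su|_]; last by rewrite !mul0r.
have -> : (u \in patset c ab `\` N) = false; last by rewrite mulr0.
by apply/negbTE; rewrite notin_setE => -[pc Nu]; apply: nU; exact/eqv.
Qed.

End Law.
Arguments dens {R n} s th u.
Arguments pr {R n} s xs th c ab.
Arguments good_obs {R n} s xs th z.

(** * Log-Lipschitz dependence of the pattern probabilities on the parameter *)

Section Lipschitz.
Context {R : realType} {n : nat}.
Local Notation vec := (n.-tuple R).
Context {s : {finite_measure set vec -> \bar R}} {xs : vec -> vec * R -> vec}.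
Hypothesis s_gt0 : (0 < s sphere)%E.
Hypothesis mxs : measurable_fun setT (fun p : vec * (vec * R) => xs p.1 p.2).

(** One factor [exp d] comes from the kernel and one from the normalizing constant. *)
Lemma pr_lipschitz (d : R) (th th' : vec * R) c ab : sphere th.1 -> sphere th'.1 ->
  (forall u, sphere u -> `|th.2 * dotp th.1 u - th'.2 * dotp th'.1 u| <= d) ->
  pr s xs th c ab <= expR (2 * d) * pr s xs th' c ab.
Proof.
move=> Sth Sth' thd.
have e1 u : sphere u -> expR (- th.2 * dotp th.1 u) <= expR d * expR (- th'.2 * dotp th'.1 u).
  move=> Su; rewrite -expRD ler_expR; have := thd u Su; rewrite ler_norml; lra.
have e2 u : sphere u -> expR (- th'.2 * dotp th'.1 u) <= expR d * expR (- th.2 * dotp th.1 u).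
  move=> Su; rewrite -expRD ler_expR; have := thd u Su; rewrite ler_norml; lra.
have Z : vmf_norm s th' <= expR d * vmf_norm s th.
  rewrite -lee_fin EFinM (vmf_normE Sth) (vmf_normE Sth') -integral_EFinZl ?expR_ge0//; last first.
    apply: measurable_funM; first exact: (measurable_cut1 th measurable_exponent).
    by apply: measurable_indic; exact: measurable_sphere.
  apply: le_lower_integral => u _; first by rewrite lee_fin mulr_ge0 ?expR_ge0.
  rewrite lee_fin mulrA indicE.
  case: (boolP (u \in _)) => [/[!inE] Su|_]; last by rewrite !mulr0.
  by rewrite !mulr1 e2.
have Z1 := vmf_norm_gt0 s_gt0 Sth; have Z1' := vmf_norm_gt0 s_gt0 Sth'.
have dd u : dens s th u <= expR (2 * d) * dens s th' u.
  rewrite /dens indicE; case: (boolP (u \in _)) => [/[!inE] Su|_]; last by rewrite !mul0r mulr0.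
  rewrite !mul1r; have cross (e e' z z' E : R) : 0 < z -> 0 < z' ->
      e * z' <= E * e' * z -> e / z <= E * (e' / z').
    by move=> z0 z0' H; rewrite ler_pdivrMr// mulrA mulrAC ler_pdivlMr.
  rewrite /vmf_density; apply: (cross _ _ _ _ _ Z1 Z1').
  have E2 : expR (2 * d) = expR d * expR d by rewrite -expRD; congr expR; rewrite mulr_natl mulr2n.
  apply: (@le_trans _ _ ((expR d * expR (- th'.2 * dotp th'.1 u)) * (expR d * vmf_norm s th))).
    by apply: ler_pM; rewrite ?expR_ge0 ?(ltW Z1')//; exact: e1.
  by rewrite E2 !mulrA [expR d * _ * expR d]mulrAC.
rewrite -lee_fin EFinM. rewrite [leLHS](prE s_gt0 c ab Sth) [X in (_ * X)%E](prE s_gt0 c ab Sth').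
have mpr : measurable_fun setT (fun u => dens s th' u * \1_[set u | pattern_of (xs u ab) = c] u).
  apply: measurable_funM; first exact: measurable_dens_cut.
  by apply: measurable_indic; apply: measurable_pattern_eq; exact: (measurable_cut2 ab mxs).
rewrite -integral_EFinZl ?expR_ge0//; last by move=> u; rewrite mulr_ge0// dens_ge0.
apply: le_lower_integral => u _; first by rewrite lee_fin mulr_ge0 ?dens_ge0.
by rewrite lee_fin mulrA ler_wpM2r.
Qed.

End Lipschitz.

(** * Construction of mixture measures *)

Section Density.
Context d d' (X : measurableType d) (Y : measurableType d') (R : realType).
Local Open Scope ereal_scope.
Variables (mu : {measure set X -> \bar R}) (w : X -> R) (phi : X -> Y).
Hypotheses (mw : measurable_fun setT w) (w0 : forall x, (0 <= w x)%R).
Hypothesis (mphi : measurable_fun setT phi).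

(** The image under [phi] of the measure with density [w] with respect to [mu]. *)
Definition pushed_density (A : set Y) : \bar R := \int[mu]_(x in phi @^-1` A) (w x)%:E.

Let pushed_density0 : pushed_density set0 = 0.
Proof. by rewrite /pushed_density preimage_set0 integral_set0. Qed.

Let pushed_density_ge0 A : 0 <= pushed_density A.
Proof. by apply: integral_ge0 => x _; rewrite lee_fin. Qed.

Let pushed_density_sigma_additive : semi_sigma_additive pushed_density.
Proof.
have mpre (A : set Y) : measurable A -> measurable (phi @^-1` A).
  by move=> mA; rewrite -[X in measurable X]setTI; exact: mphi.
have mw' : measurable_fun setT (EFin \o w) by exact/measurable_EFinP.
have w0' x : 0 <= (EFin \o w) x by rewrite lee_fin.
move=> F mF tF mUF; rewrite /pushed_density preimage_bigcup.
apply: (@semi_sigma_additive_nng_induced _ _ _ mu _ mw' w0' (fun k => phi @^-1` F k)).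
- by move=> k; exact: mpre.
- by apply/trivIsetP => i j _ _ ij; rewrite -preimage_setI (trivIsetP.1 tF i j I I ij) preimage_set0.
- by rewrite -preimage_bigcup; exact: mpre.
Qed.

HB.instance Definition _ := isMeasure.Build _ _ _ pushed_density
  pushed_density0 pushed_density_ge0 pushed_density_sigma_additive.

Lemma exists_pushed_density : exists m : {measure set Y -> \bar R},
  forall A, m A = \int[mu]_(x in phi @^-1` A) (w x)%:E.
Proof. by exists pushed_density. Qed.

End Density.

Section Mixture.
Context d d' (X : measurableType d) (Y : measurableType d') (R : realType).
Local Open Scope ereal_scope.

Lemma exists_mixture_measure (I : Type) (r : seq I) (P : {measure set X -> \bar R})
    (w : I -> X -> R) (phi : I -> X -> Y) :
  (forall i, measurable_fun setT (w i)) -> (forall i x, (0 <= w i x)%R) ->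
  (forall i, measurable_fun setT (phi i)) ->
  exists m : {measure set Y -> \bar R}, forall A, measurable A ->
    m A = \int[P]_x (\sum_(i <- r) w i x * \1_A (phi i x))%:E.
Proof.
move=> mw w0 mphi; elim: r => [|i r [m mE]].
  exists mzero => A mA; rewrite /mzero.
  by under eq_integral do rewrite big_nil; rewrite integral0.
have [D DE] := exists_pushed_density P (mw i) (w0 i) (mphi i).
exists (measure_add D m) => A mA.
have mpA j : measurable (phi j @^-1` A).
  by rewrite -[X in measurable X]setTI; exact: mphi.
have mI j : measurable_fun setT (fun x => w j x * \1_A (phi j x))%R.
  by apply: measurable_funM => //; apply: (measurableT_comp _ (mphi j)); exact: measurable_indic.
transitivity (D A + m A); first exact: measure_addE.
rewrite mE// DE.
under [RHS]eq_integral do rewrite big_cons EFinD.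
rewrite ge0_integralD//.
- congr (_ + _); rewrite integral_mkcond; apply: eq_integral => x _.
  rewrite patchE indicE; case: ifPn => [|].
    by rewrite inE /= => Ax; rewrite mem_set// mulr1.
  by rewrite notin_setE /= => Ax; rewrite memNset// mulr0.
- by move=> x _; rewrite lee_fin mulr_ge0.
- exact/measurable_EFinP.
- by move=> x _; rewrite lee_fin sumr_ge0// => j _; rewrite mulr_ge0.
- by apply/measurable_EFinP; apply: measurable_sum.
Qed.

(** This builds couplings: draw [x] from [P], choose [i] with weight [w i x], and return
    [phi i x]. *)
Lemma exists_mixture (I : finType) (P : {measure set X -> \bar R})
    (w : I -> X -> R) (phi : I -> X -> Y) :
  (forall i, measurable_fun setT (w i)) -> (forall i x, (0 <= w i x)%R) ->
  (forall i, measurable_fun setT (phi i)) ->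
  \int[P]_x (\sum_i w i x)%:E = 1 ->
  exists g : probability Y R, forall A, measurable A ->
    g A = \int[P]_x (\sum_i w i x * \1_A (phi i x))%:E.
Proof.
move=> mw w0 mphi w1.
have [m mE] := exists_mixture_measure (index_enum I) P mw w0 mphi.
have mT : m setT = 1.
  rewrite mE// -w1; apply: eq_integral => x _; congr EFin; apply: eq_bigr => i _.
  by rewrite indicT mulr1.
(* Normalization serves only to attach the probability structure, the mass being 1 already; it
   requires a default measure, hence a point of [Y]. *)
have [y _] : exists y : Y, True.
  have [[y _]|/forallNP Y0] := pselect (exists y : Y, True); first by exists y.
  have : m setT = 0.
    rewrite (_ : setT = set0) ?measure0//; apply/seteqP; split => [y _|//].
    by have := Y0 y.
  by rewrite mT => /eqP; rewrite onee_eq0.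
exists (mnormalize m (dirac y)) => A mA.
have mT' : (m setT == +oo) = false by rewrite mT.
by rewrite -mE//= /mnormalize mT' (_ : (m setT == 0) = false) ?mT ?onee_eq0//= invr1 mule1.
Qed.

End Mixture.

(** * Total variation, Hellinger affinity and maximal coupling on a finite set *)

Section FiniteDistributions.
Context (R : realType) (I : finType).
Variables p q : I -> R.
Hypotheses (p0 : forall i, 0 <= p i) (q0 : forall i, 0 <= q i).
Hypotheses (p1 : \sum_i p i = 1) (q1 : \sum_i q i = 1).

Definition tv : R := \sum_i Num.max (p i - q i) 0.

Lemma tv_ge0 : 0 <= tv.
Proof. by apply: sumr_ge0 => i _; rewrite le_max lexx orbT. Qed.

Lemma tvE : tv = \sum_i Num.max (q i - p i) 0.
Proof.
apply/eqP; rewrite -subr_eq0 /tv -sumrB; apply/eqP.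
rewrite (eq_bigr (fun i => p i - q i)) ?sumrB ?p1 ?q1 ?subrr// => i _.
by rewrite -[q i - _]opprB; case: (leP (p i - q i) 0) => h; case: (leP (- (p i - q i)) 0) => h'; lra.
Qed.

Lemma hellinger_affinity_le1 : \sum_i Num.sqrt (p i * q i) <= 1.
Proof.
have -> : 1 = \sum_i (p i + q i) / 2 :> R by rewrite -mulr_suml big_split/= p1 q1; lra.
apply: ler_sum => i _; rewrite sqrtrM//.
have := sqr_sqrtr (p0 i); have := sqr_sqrtr (q0 i).
by have := sqr_ge0 (Num.sqrt (p i) - Num.sqrt (q i)); nra.
Qed.

(** A linearized form of [tv <= sqrt (1 - h^2)], where [h] is the affinity. Being affine in [h] with
    a free parameter [t], it can be integrated over [(a, b)] before [t] is chosen. The terms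
    [(p i - q i) / 2] in [H] come from writing the positive part through the absolute value; they
    cancel in the sum. *)
Lemma tv_le_hellinger (t : R) : 0 < t ->
  tv <= (1 - \sum_i Num.sqrt (p i * q i)) / (2 * t) + t.
Proof.
move=> t0; set h := \sum_i Num.sqrt (p i * q i).
have h1 : h <= 1 by exact: hellinger_affinity_le1.
have H i : Num.max (p i - q i) 0 <= (p i - q i) / 2 +
    (p i + q i - 2 * Num.sqrt (p i * q i)) / (4 * t) +
    t * (p i + q i + 2 * Num.sqrt (p i * q i)) / 4.
  rewrite sqrtrM//; have := sqr_sqrtr (p0 i); have := sqr_sqrtr (q0 i).
  have := sqrtr_ge0 (p i); have := sqrtr_ge0 (q i).
  move: (Num.sqrt (p i)) (Num.sqrt (q i)) => a b b0 a0 <- <-.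
  have -> : a ^+ 2 + b ^+ 2 - 2 * (a * b) = (a - b) ^+ 2 by ring.
  have -> : a ^+ 2 + b ^+ 2 + 2 * (a * b) = (a + b) ^+ 2 by ring.
  (* AM-GM: [2 |a - b| (a + b) <= (a - b)^2 / t + t (a + b)^2] *)
  have P1 : 2 * (a - b) * (a + b) <= (a - b) ^+ 2 / t + t * (a + b) ^+ 2.
    have := sqr_ge0 ((a - b) - t * (a + b)) => S.
    rewrite -subr_ge0 (_ : _ - _ = ((a - b) - t * (a + b)) ^+ 2 / t); last by field; rewrite gt_eqF.
    by rewrite divr_ge0// ltW.
  have P2 : - 2 * (a - b) * (a + b) <= (a - b) ^+ 2 / t + t * (a + b) ^+ 2.
    rewrite -subr_ge0 (_ : _ - _ = ((a - b) + t * (a + b)) ^+ 2 / t); last by field; rewrite gt_eqF.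
    by rewrite divr_ge0 ?sqr_ge0// ltW.
  have E : (a - b) ^+ 2 / (4 * t) = (a - b) ^+ 2 / t / 4 by field; rewrite gt_eqF.
  rewrite -addrA E; move: P1 P2; move: ((a - b) ^+ 2 / t) (t * (a + b) ^+ 2) => z1 z2 P1 P2.
  by rewrite ge_max; apply/andP; split; nra.
apply: (@le_trans _ _ (\sum_i ((p i - q i) / 2 +
    (p i + q i - 2 * Num.sqrt (p i * q i)) / (4 * t) +
    t * (p i + q i + 2 * Num.sqrt (p i * q i)) / 4))); first exact: ler_sum.
rewrite !big_split/= -!mulr_suml -mulr_sumr !big_split/= !sumrN -!mulr_sumr p1 q1 -/h.
rewrite [leLHS](_ : _ = (1 - h) / (2 * t) + t * (1 + h) / 2); last by field; rewrite gt_eqF.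
by rewrite lerD2l; nra.
Qed.

(* The maximal coupling; division by [tv = 0] is harmless since both excesses then vanish. *)
Definition max_coupling (ij : I * I) : R :=
  (ij.1 == ij.2)%:R * Num.min (p ij.1) (q ij.1) +
  Num.max (p ij.1 - q ij.1) 0 * Num.max (q ij.2 - p ij.2) 0 / tv.

Lemma max_coupling_ge0 ij : 0 <= max_coupling ij.
Proof.
rewrite addr_ge0//; first by rewrite mulr_ge0// le_min p0 q0.
by rewrite divr_ge0 ?tv_ge0// mulr_ge0// le_max lexx orbT.
Qed.

Let excess_tv (e : I -> R) i : (forall i, 0 <= e i) -> \sum_i e i = tv -> e i * tv / tv = e i.
Proof.
move=> e0 etv; have [z|nz] := eqVneq tv 0; last by rewrite mulfK.
have : \sum_i e i = 0 by rewrite etv.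
by move/psumr_eq0P => /(_ (fun i _ => e0 i) i isT) ->; rewrite !mul0r.
Qed.

Let max0_ge0 (x : R) : 0 <= Num.max x 0. Proof. by rewrite le_max lexx orbT. Qed.

Lemma max_coupling_fst i : \sum_j max_coupling (i, j) = p i.
Proof.
rewrite big_split/= -!mulr_suml -mulr_sumr -tvE (excess_tv (e := fun i => Num.max (p i - q i) 0))//.
rewrite (bigD1 i)//= eqxx big1 ?addr0 ?mul1r => [|j]; last by rewrite eq_sym => /negbTE ->.
by case: (leP (p i) (q i)) => h; case: (leP (p i - q i) 0) => h'; lra.
Qed.

Lemma max_coupling_snd j : \sum_i max_coupling (i, j) = q j.
Proof.
rewrite big_split/= -!mulr_suml -/tv [tv * _]mulrC.
rewrite (excess_tv (e := fun i => Num.max (q i - p i) 0)) -?tvE//.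
rewrite (bigD1 j)//= eqxx big1 ?addr0 ?mul1r => [|i /negbTE ->]; last by rewrite mul0r.
by case: (leP (p j) (q j)) => h; case: (leP (q j - p j) 0) => h'; lra.
Qed.

Lemma max_coupling_offdiag : \sum_(ij : I * I) (ij.1 != ij.2)%:R * max_coupling ij <= tv.
Proof.
apply: (@le_trans _ _ (\sum_(ij : I * I)
    Num.max (p ij.1 - q ij.1) 0 * Num.max (q ij.2 - p ij.2) 0 / tv)).
  apply: ler_sum => ij _; rewrite /max_coupling; case: eqP => _ /=.
    by rewrite mul0r divr_ge0 ?tv_ge0// mulr_ge0.
  by rewrite mul1r mul0r add0r.
rewrite -(pair_bigA _ (fun i j => Num.max (p i - q i) 0 * Num.max (q j - p j) 0 / tv))/=.
under eq_bigr do rewrite -mulr_suml -mulr_sumr -tvE.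
rewrite (eq_bigr (fun i => Num.max (p i - q i) 0))// => i _.
exact: (excess_tv (e := fun i => Num.max (p i - q i) 0)).
Qed.

End FiniteDistributions.

Lemma measurable_tv d (T : measurableType d) (R : realType) (I : finType) (p q : I -> T -> R) :
  (forall i, measurable_fun setT (p i)) -> (forall i, measurable_fun setT (q i)) ->
  measurable_fun setT (fun x => tv (p ^~ x) (q ^~ x)).
Proof.
move=> mp mq; apply: measurable_sum => i.
by apply: measurable_maxr => //; exact: measurable_funB.
Qed.

Lemma measurable_max_coupling d (T : measurableType d) (R : realType) (I : finType)
    (p q : I -> T -> R) (ij : I * I) :
  (forall i, measurable_fun setT (p i)) -> (forall i, measurable_fun setT (q i)) ->
  measurable_fun setT (fun x => max_coupling (p ^~ x) (q ^~ x) ij).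
Proof.
move=> mp mq; apply: measurable_funD.
  by apply: measurable_funM => //; exact: measurable_minr.
apply: measurable_funM; last by apply: measurable_funV; exact: measurable_tv.
by apply: measurable_funM; apply: measurable_maxr => //; exact: measurable_funB.
Qed.

(** * Wasserstein distance bounded by the affinity *)

Section WassersteinBound.
Context {R : realType} {n : nat}.
Local Notation vec := (n.-tuple R).
Context {s : {finite_measure set vec -> \bar R}} {Pab : probability (vec * R)%type R}
  {xs : vec -> vec * R -> vec}.
Hypothesis s_gt0 : (0 < s sphere)%E.
Hypothesis mxs : measurable_fun setT (fun p : vec * (vec * R) => xs p.1 p.2).
Hypothesis admissible_ae : {ae Pab, forall ab, admissible ab}.
Hypothesis nongeneric_null : forall a : vec, (forall i, 0 < tnth a i) ->
  {ae s, forall u, generic u a}.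
Hypothesis xs_opt : forall u (ab : vec * R), admissible ab -> LP_optimal u ab.1 ab.2 (xs u ab).

Definition affinity_at (th th' : vec * R) (ab : vec * R) : R :=
  \sum_c Num.sqrt (pr s xs th c ab * pr s xs th' c ab).

(** Both parameters share the law of [(a, b)], so the affinity of the joint laws is the average of
    the conditional ones. *)
Definition affinity (th th' : vec * R) : R := fine (\int[Pab]_ab (affinity_at th th' ab)%:E).

Lemma affinity_at_ge0 th th' ab : 0 <= affinity_at th th' ab.
Proof. by apply: sumr_ge0 => c _; exact: sqrtr_ge0. Qed.

Lemma affinity_at_le1 th th' ab : sphere th.1 -> sphere th'.1 -> affinity_at th th' ab <= 1.
Proof.
move=> Sth Sth'; apply: hellinger_affinity_le1; rewrite ?sum_pr// => c; exact: pr_ge0.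
Qed.

Lemma measurable_affinity_at th' :
  measurable_fun setT (fun p : (vec * R) * (vec * R) => affinity_at p.1 th' p.2).
Proof.
apply: measurable_sum => c; apply: measurable_funsqrt; apply: measurable_funM.
  exact: measurable_pr.
by apply: (measurableT_comp _ measurable_snd); exact: (measurable_cut1 th' (measurable_pr mxs c)).
Qed.

Lemma measurable_affinity th' : measurable_fun setT (affinity ^~ th').
Proof.
apply: (measurableT_comp (f := fine)) => //.
apply: (@measurable_integral_snd _ _ _ _ _ Pab (fun p => (affinity_at p.1 th' p.2)%:E)).
  by apply/measurable_EFinP; exact: measurable_affinity_at.
by move=> p; rewrite lee_fin affinity_at_ge0.
Qed.

Let integral_one : (\int[Pab]_ab 1%:E = 1 :> \bar R)%E.
Proof. by rewrite integral_cst// mul1e; exact: probability_setT. Qed.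

Lemma affinityE th th' : sphere th.1 -> sphere th'.1 ->
  (affinity th th')%:E = (\int[Pab]_ab (affinity_at th th' ab)%:E)%E.
Proof.
move=> Sth Sth'; rewrite fineK// ge0_fin_numE; last first.
  by apply: integral_ge0 => ab _; rewrite lee_fin affinity_at_ge0.
apply: (@le_lt_trans _ _ 1%E); last exact: ltry.
rewrite -integral_one; apply: le_lower_integral => ab _; rewrite lee_fin.
  exact: affinity_at_ge0.
exact: affinity_at_le1.
Qed.

Lemma affinity_ge0 th th' : 0 <= affinity th th'.
Proof. by apply: fine_ge0; apply: integral_ge0 => ab _; rewrite lee_fin affinity_at_ge0. Qed.

Let measurable_obs_dist :
  measurable_fun setT (fun p : (vec * (vec * R)) * (vec * (vec * R)) => obs_dist p.1 p.2).
Proof.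
rewrite /obs_dist; apply: measurable_funsqrt.
have m1 : measurable_fun setT (fun p : (vec * (vec * R)) * (vec * (vec * R)) => p.1.2).
  exact: (measurableT_comp measurable_snd measurable_fst).
have m2 : measurable_fun setT (fun p : (vec * (vec * R)) * (vec * (vec * R)) => p.2.2).
  exact: (measurableT_comp measurable_snd measurable_snd).
apply: measurable_funD; first apply: measurable_funD.
- apply: measurable_sqdist; first exact: (measurableT_comp measurable_fst measurable_fst).
  exact: (measurableT_comp measurable_fst measurable_snd).
- apply: measurable_sqdist; first exact: (measurableT_comp measurable_fst m1).
  exact: (measurableT_comp measurable_fst m2).
- apply: measurable_funX; apply: measurable_funB; first exact: (measurableT_comp measurable_snd m1).
  exact: (measurableT_comp measurable_snd m2).
Qed.

Let at_vertices (cc : pattern * pattern) (ab : vec * R) : obs * obs :=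
  ((vertex cc.1 ab, ab), (vertex cc.2 ab, ab)).

Let sqdistxx (v : vec) : sqdist v v = 0.
Proof. by rewrite /sqdist big1// => i _; rewrite subrr expr0n. Qed.

Let obs_dist_at_vertices cc ab : obs_dist (at_vertices cc ab).1 (at_vertices cc ab).2 =
  Num.sqrt (sqdist (vertex cc.1 ab) (vertex cc.2 ab)).
Proof. by rewrite /obs_dist /= sqdistxx subrr expr0n /= !addr0. Qed.

(** The two observations are given the same [(a, b)], and their patterns are drawn from the maximal
    coupling of the conditional laws. They then differ only in vertices of the unit cube program, at
    distance at most [sqrt n], and only when the patterns differ, which has conditional probability
    at most [tv]. *)
Lemma wasserstein_le_affinity th th' (t : R) : sphere th.1 -> sphere th'.1 -> 0 < t ->
  (wasserstein s Pab xs th th' <=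
    (Num.sqrt n%:R * ((1 - affinity th th') / (2 * t) + t))%:E)%E.
Proof.
move=> Sth Sth' t0.
pose p := pr s xs th; pose q := pr s xs th'.
have p0 c ab : 0 <= p c ab by exact: pr_ge0.
have q0 c ab : 0 <= q c ab by exact: pr_ge0.
have p1 ab : \sum_c p c ab = 1 by exact: sum_pr.
have q1 ab : \sum_c q c ab = 1 by exact: sum_pr.
have mp c : measurable_fun setT (p c) by exact: (measurable_cut1 th (measurable_pr mxs c)).
have mq c : measurable_fun setT (q c) by exact: (measurable_cut1 th' (measurable_pr mxs c)).
pose w cc ab := max_coupling (p ^~ ab) (q ^~ ab) cc.
have w0 cc ab : 0 <= w cc ab by exact: (max_coupling_ge0 (p0^~ ab) (q0^~ ab)).
have mw cc : measurable_fun setT (w cc) by exact: (@measurable_max_coupling _ _ _ _ p q cc mp mq).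
have mv cc : measurable_fun setT (at_vertices cc).
  by apply: measurable_fun_pair; apply: measurable_fun_pair => //; exact: measurable_vertex.
have wfst c ab : \sum_c' w (c, c') ab = p c ab by exact: (max_coupling_fst (p1 ab) (q1 ab)).
have wsnd c' ab : \sum_c w (c, c') ab = q c' ab by exact: (max_coupling_snd (p1 ab) (q1 ab)).
have w1 : (\int[Pab]_ab (\sum_cc w cc ab)%:E = 1)%E.
  rewrite -[RHS]integral_one; apply: eq_integral => ab _; congr EFin.
  rewrite -(p1 ab) -(pair_bigA _ (fun c c' => w (c, c') ab))/=.
  exact: eq_bigr.
have [g gE] := exists_mixture mw w0 mv w1.
have gcoupling : coupling s Pab xs th th' g.
  move=> A mA; have mI : measurable_fun setT (fun z : vec * (vec * R) => (\1_A z)%:E : \bar R).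
    by apply/measurable_EFinP; exact: measurable_indic.
  split.
  - rewrite gE; last exact: measurableX.
    rewrite law_intE//.
    apply: eq_integral => ab _; under [RHS]eq_bigr do rewrite -EFinM.
    rewrite sumEFin; congr EFin.
    rewrite -(pair_bigA _ (fun c c' => w (c, c') ab * \1_(A `*` setT) (at_vertices (c, c') ab)))/=.
    apply: eq_bigr => c _; rewrite -/(p c ab) -wfst mulr_sumr; apply: eq_bigr => c' _.
    rewrite mulrC; congr (_ * _); rewrite !indicE; congr (_%:R); congr nat_of_bool.
    by apply/idP/idP; rewrite !inE /=; [case|].
  - rewrite gE; last exact: measurableX.
    rewrite law_intE//.
    apply: eq_integral => ab _; under [RHS]eq_bigr do rewrite -EFinM.
    rewrite sumEFin; congr EFin.
    rewrite -(pair_bigA _ (fun c c' => w (c, c') ab * \1_(setT `*` A) (at_vertices (c, c') ab)))/=.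
    rewrite exchange_big/=; apply: eq_bigr => c _; rewrite -/(q c ab) -wsnd mulr_sumr.
    apply: eq_bigr => c' _.
    rewrite mulrC; congr (_ * _); rewrite !indicE; congr (_%:R); congr nat_of_bool.
    by apply/idP/idP; rewrite !inE /=; [case|].
apply: (@le_trans _ _ (\int[g]_z (obs_dist z.1 z.2)%:E)%E).
  by apply: ereal_inf_lbound; exists g.
have sn0 : 0 <= Num.sqrt n%:R :> R by exact: sqrtr_ge0.
pose E := [set z : (vec * (vec * R)) * (vec * (vec * R)) | 0 < obs_dist z.1 z.2].
have mE : measurable E by apply: measurable_ltfun => //; exact: measurable_obs_dist.
pose N := [set z : (vec * (vec * R)) * (vec * (vec * R)) | Num.sqrt n%:R < obs_dist z.1 z.2].
have mN : measurable N by apply: measurable_ltfun => //; exact: measurable_obs_dist.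
have gN : g N = 0%E.
  rewrite gE//; apply: integral0_eq => ab _; congr EFin; apply: big1 => cc _.
  rewrite indicE memNset ?mulr0// /N /mkset obs_dist_at_vertices => /lt_geF.
  by rewrite ler_wsqrtr// vertex_sqdist.
apply: (@le_trans _ _ (\int[g]_z (Num.sqrt n%:R * \1_E z)%:E)%E).
  have m1 : measurable_fun setT (fun z : (vec * (vec * R)) * (vec * (vec * R)) => (obs_dist z.1 z.2)%:E).
    by apply/measurable_EFinP; exact: measurable_obs_dist.
  have m2 : measurable_fun setT (fun z => ((Num.sqrt n%:R : R) * \1_E z)%:E).
    apply/measurable_EFinP. apply: measurable_funM => //; exact: measurable_indic.
  have g1 z : setT z -> (0 <= (obs_dist z.1 z.2)%:E)%E by rewrite lee_fin sqrtr_ge0.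
  have g2 z : setT z -> (0 <= (Num.sqrt n%:R * \1_E z)%:E)%E by rewrite lee_fin mulr_ge0.
  apply: ae_ge0_le_integral; [exact: measurableT|exact: g1|exact: m1|exact: g2|exact: m2|].
  exists N; split => // z /= /not_implyP[_ /negP]; rewrite lee_fin -ltNge indicE.
  have [Ez|Ez] := pselect (E z); first by rewrite mem_set// mulr1.
  by rewrite memNset// mulr0 => z0; exfalso; exact: Ez.
rewrite integral_EFinZl//.
rewrite integral_indic// setIT EFinM; apply: lee_wpmul2l; first by rewrite lee_fin.
rewrite [leLHS](gE E mE).
pose tau ab := tv (p ^~ ab) (q ^~ ab).
have mtau : measurable_fun setT tau by exact: (@measurable_tv _ _ _ _ p q mp mq).
have maff : measurable_fun setT (affinity_at th th').
  exact: (measurable_cut1 th (measurable_affinity_at th')).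
apply: (@le_trans _ _ (\int[Pab]_ab (tau ab)%:E)%E).
  apply: le_lower_integral => ab _.
    by rewrite lee_fin sumr_ge0// => cc _; rewrite mulr_ge0.
  rewrite lee_fin; apply: le_trans (max_coupling_offdiag (p1 ab) (q1 ab)).
  apply: ler_sum => cc _; rewrite mulrC -/(w cc ab); apply: ler_wpM2r => //.
  rewrite indicE; case: (boolP (_ \in E)) => // /[!inE]; rewrite /E /mkset obs_dist_at_vertices.
  by case: eqP => // ->; rewrite sqdistxx sqrtr0 ltxx.
have tau_le ab : tau ab + affinity_at th th' ab / (2 * t) <= 1 / (2 * t) + t.
  have := tv_le_hellinger (p0^~ ab) (q0^~ ab) (p1 ab) (q1 ab) t0.
  rewrite -/(affinity_at th th' ab) -/(tau ab) mulrBl; lra.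
have t2 : 0 <= (2 * t)^-1 by rewrite invr_ge0; lra.
(* The affinity stays on the left, so that only nonnegative functions are integrated; it is
   subtracted once it is a finite number. *)
have H : (\int[Pab]_ab (tau ab)%:E + ((2 * t)^-1 * affinity th th')%:E <= (1 / (2 * t) + t)%:E)%E.
  rewrite EFinM affinityE// -integral_EFinZl//; last by move=> ab; exact: affinity_at_ge0.
  rewrite -ge0_integralD//; last 4 first.
  - by move=> ab _; rewrite lee_fin tv_ge0.
  - exact/measurable_EFinP.
  - by move=> ab _; rewrite lee_fin mulr_ge0// affinity_at_ge0.
  - by apply/measurable_EFinP; exact: measurable_funM.
  rewrite -[leRHS]mule1 -[X in (_ <= _ * X)%E]integral_one -integral_EFinZl//; last first.
    by rewrite addr_ge0 ?divr_ge0// ?ltW// mulr_gt0.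
  apply: le_lower_integral => ab _.
    by rewrite adde_ge0// lee_fin ?tv_ge0// mulr_ge0// affinity_at_ge0.
  by rewrite -EFinD lee_fin mulr1 [_ * affinity_at _ _ _]mulrC.
rewrite -leeBrDr// in H; apply: (le_trans H).
by rewrite -EFinB lee_fin mulrBl; lra.
Qed.

End WassersteinBound.
Arguments affinity_at {R n} s xs th th' ab.
Arguments affinity {R n} s Pab xs th th'.

(** * Expectations over the dataset, one observation at a time *)

Section PosteriorRecursion.
Context {R : realType} {n : nat}.
Local Notation vec := (n.-tuple R).
Context {s : {finite_measure set vec -> \bar R}} {Pab : probability (vec * R)%type R}
  {xs : vec -> vec * R -> vec}.
Hypothesis s_gt0 : (0 < s sphere)%E.
Hypothesis mxs : measurable_fun setT (fun p : vec * (vec * R) => xs p.1 p.2).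
Hypothesis admissible_ae : {ae Pab, forall ab, admissible ab}.
Hypothesis nongeneric_null : forall a : vec, (forall i, 0 < tnth a i) ->
  {ae s, forall u, generic u a}.
Hypothesis xs_opt : forall u (ab : vec * R), admissible ab -> LP_optimal u ab.1 ab.2 (xs u ab).
Context (pi0 : {sigma_finite_measure set (vec * R)%type -> \bar R}).
Context {th0 : vec * R}.
Hypothesis Sth0 : sphere th0.1.

Definition obs_pr (th : vec * R) (z : vec * (vec * R)) : R := pr s xs th (pattern_of z.1) z.2.

Definition sqrt_ratio (th : vec * R) (z : vec * (vec * R)) : R :=
  Num.sqrt (obs_pr th z / obs_pr th0 z).

Lemma sqrt_ratio_ge0 th z : 0 <= sqrt_ratio th z.
Proof. exact: sqrtr_ge0. Qed.

Lemma obs_pr_ge0 th z : 0 <= obs_pr th z.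
Proof. exact: pr_ge0. Qed.

Lemma obs_pr_le1 th z : sphere th.1 -> obs_pr th z <= 1.
Proof.
move=> Sth; rewrite -(sum_pr s_gt0 mxs z.2 Sth) (bigD1 (pattern_of z.1))//= lerDl.
by apply: sumr_ge0 => c _; exact: pr_ge0.
Qed.

Lemma measurable_obs_pr :
  measurable_fun setT (fun p : (vec * R) * (vec * (vec * R)) => obs_pr p.1 p.2).
Proof.
rewrite (_ : (fun _ => _) = fun p : (vec * R) * (vec * (vec * R)) => \sum_c
    pr s xs p.1 c p.2.2 * \1_[set z | pattern_of z.1 = c] p.2); last first.
  apply/funext => p; rewrite (bigD1 (pattern_of p.2.1))//= indicE mem_set// mulr1.
  by rewrite big1 ?addr0// => c /eqP pc; rewrite indicE memNset ?mulr0// => /esym.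
apply: measurable_sum => c; apply: measurable_funM.
  have m1 : measurable_fun setT (fun p : (vec * R) * (vec * (vec * R)) => (p.1, p.2.2)).
    apply: measurable_fun_pair => //.
    exact: (measurableT_comp measurable_snd measurable_snd).
  exact: (measurableT_comp (measurable_pr mxs c) m1).
have mA : measurable [set z : vec * (vec * R) | pattern_of z.1 = c].
  exact: measurable_pattern_eq.
exact: (measurableT_comp (measurable_indic mA) measurable_snd).
Qed.

Lemma measurable_sqrt_ratio :
  measurable_fun setT (fun p : (vec * R) * (vec * (vec * R)) => sqrt_ratio p.1 p.2).
Proof.
apply: measurable_funsqrt; apply: measurable_funM; first exact: measurable_obs_pr.
apply: measurable_funV.
exact: (measurableT_comp (measurable_cut1 th0 measurable_obs_pr) measurable_snd).
Qed.

Let patset c ab := [set u | pattern_of (xs u ab) = c].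

(** A pattern of positive probability is attained by some generic [u], and its vertex is then the
    solution for [u]. For other patterns the clipping in [vertex] may change the pattern. *)
Lemma pattern_of_vertex c ab : admissible ab -> 0 < pr s xs th0 c ab ->
  pattern_of (vertex c ab) = c.
Proof.
move=> adm pr0; apply: contrapT => cN.
have E : (\int[s]_u (dens s th0 u * \1_(patset c ab) u)%:E = 0)%E.
  rewrite -(@integral0 _ _ _ s setT); apply: ge0_ae_eq_integral => //.
  - apply/measurable_EFinP; apply: measurable_funM; first exact: measurable_dens_cut.
    by apply: measurable_indic; apply: measurable_pattern_eq; exact: (measurable_cut2 ab mxs).
  - by move=> u _; rewrite lee_fin mulr_ge0// dens_ge0.
  apply: filterS (nongeneric_null adm.1) => u ug _ /=.
  rewrite indicE memNset ?mulr0// => uc; apply: cN.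
  by rewrite -uc vertex_xs.
by move: pr0; rewrite -lte_fin [X in (_ < X)%E](prE s_gt0 c ab Sth0) E ltxx.
Qed.

(* The Hellinger affinity is the expected square root of the likelihood ratio. *)
Lemma law_int_sqrt_ratio (v : vec * R -> R) : measurable_fun setT v -> (forall th, 0 <= v th) ->
  (forall th, v th != 0 -> sphere th.1) ->
  (law_int s Pab xs th0 (fun z => \int[pi0]_th (v th * sqrt_ratio th z)%:E) =
   \int[pi0]_th (v th * affinity s Pab xs th th0)%:E)%E.
Proof.
move=> mv v0 vS.
pose f (p : (vec * R) * (vec * (vec * R))) := (v p.1 * sqrt_ratio p.1 p.2)%:E.
have mf : measurable_fun setT f.
  apply/measurable_EFinP; apply: measurable_funM; last exact: measurable_sqrt_ratio.
  exact: (measurableT_comp mv).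
have f0 p : (0 <= f p)%E by rewrite lee_fin mulr_ge0// sqrt_ratio_ge0.
have mH : measurable_fun setT (fun z => \int[pi0]_th f (th, z))%E.
  exact: (measurable_integral_fst pi0 mf f0).
have H0 z : (0 <= \int[pi0]_th f (th, z))%E by apply: integral_ge0.
rewrite (law_intE s_gt0 mxs admissible_ae nongeneric_null xs_opt Sth0 mH H0).
pose h (p : (vec * R) * (vec * R)) := (v p.1 * affinity_at s xs p.1 th0 p.2)%:E.
have mh : measurable_fun setT h.
  apply/measurable_EFinP; apply: measurable_funM; last exact: measurable_affinity_at.
  exact: (measurableT_comp mv).
have h0 p : (0 <= h p)%E by rewrite lee_fin mulr_ge0// affinity_at_ge0.
transitivity (\int[Pab]_ab \int[pi0]_th h (th, ab))%E; last first.
  rewrite -integral_swap//; apply: eq_integral => th _; rewrite /h /=.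
  have [->|/vS Sth] := eqVneq (v th) 0.
    by rewrite mul0r; under eq_integral do rewrite mul0r; exact: integral0.
  rewrite integral_EFinZl//.
  - by rewrite EFinM; congr (_ * _)%E; rewrite affinityE.
  - exact: (measurable_cut1 th (measurable_affinity_at mxs th0)).
  - by move=> ab; exact: affinity_at_ge0.
apply: ge0_ae_eq_integral => //.
- apply: emeasurable_sum => c; apply: emeasurable_funM.
    have m1 : measurable_fun setT (fun ab : vec * R => (vertex c ab, ab)).
      by apply: measurable_fun_pair => //; exact: measurable_vertex.
    exact: (measurableT_comp mH m1).
  apply/measurable_EFinP; exact: (measurable_cut1 th0 (measurable_pr mxs c)).
- exact: (measurable_integral_fst pi0 mh h0).
- by move=> ab _; apply: sume_ge0 => c _; rewrite mule_ge0// lee_fin pr_ge0.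
- by move=> ab _; apply: integral_ge0.
apply: filterS admissible_ae => ab adm _ /=.
under eq_bigr => c _.
  rewrite muleC -ge0_integralZl//; first over.
  - exact: (measurable_cut2 (vertex c ab, ab) mf).
  - by rewrite lee_fin pr_ge0.
rewrite -ge0_integral_sum//; first last.
- by move=> c th _; rewrite mule_ge0// lee_fin pr_ge0.
- by move=> c; apply: measurable_funeM; exact: (measurable_cut2 (vertex c ab, ab) mf).
apply: eq_integral => th _; rewrite /h /f /=.
under eq_bigr do rewrite -EFinM.
rewrite sumEFin; congr EFin; rewrite mulr_sumr; apply: eq_bigr => c _.
(* This is [q sqrt (p / q) = sqrt (p q)]. When [q = 0] both sides are 0, and the pattern of the
   vertex need not be known. *)
have key : pr s xs th0 c ab * sqrt_ratio th (vertex c ab, ab) =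
    Num.sqrt (pr s xs th c ab * pr s xs th0 c ab).
  have := pr_ge0 (s := s) (xs := xs) th0 c ab; rewrite le_eqVlt => /predU1P[p0|pr0].
    by rewrite -p0 mul0r mulr0 sqrtr0.
  rewrite /sqrt_ratio /obs_pr [(vertex c ab, ab).1]/=
    [(vertex c ab, ab).2]/= (pattern_of_vertex adm pr0).
  move: (pr_ge0 (s := s) (xs := xs) th c ab) pr0.
  move: (pr s xs th c ab) (pr s xs th0 c ab) => /= p q p0 q0.
  have q2 := sqr_sqrtr (ltW q0); have sq0 : 0 < Num.sqrt q by rewrite sqrtr_gt0.
  rewrite (sqrtrM _ p0) (sqrtrM _ p0) (sqrtrV (ltW q0)); move: q2 sq0.
  move: (Num.sqrt p) (Num.sqrt q) => x y <- y0.
  by field; rewrite gt_eqF.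
rewrite -key; move: (pr s xs th0 c ab) (sqrt_ratio _ _) => x y.
by rewrite mulrCA.
Qed.

Lemma law_int_ge0 th (g : vec * (vec * R) -> \bar R) : (forall z, 0 <= g z)%E ->
  (0 <= law_int s Pab xs th g)%E.
Proof.
move=> g0; rewrite law_int_dens; apply: integral_ge0 => u _.
by rewrite mule_ge0 ?lee_fin ?dens_ge0// integral_ge0.
Qed.

Lemma iid_expect_ge0 th T (g : seq (vec * (vec * R)) -> \bar R) : (forall D, 0 <= g D)%E ->
  (0 <= iid_expect (law_int s Pab xs th) T g)%E.
Proof.
elim: T g => [|T IH] g g0 //=; apply: law_int_ge0 => z.
by apply: IH.
Qed.

(** Lower integrals of a nonmeasurable [g] cannot be added to others. On good observations [g]
    dominates the measurable function [k = max (1 - H, 0)], where [H] is the integral over the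
    parameter; [k + H >= 1] holds everywhere, and additivity is applied to [k] and [H]. *)
Let one_step (v : vec * R -> R) (g : vec * (vec * R) -> \bar R) :
  measurable_fun setT v -> (forall th, 0 <= v th) -> (forall th, v th != 0 -> sphere th.1) ->
  (forall z, 0 <= g z)%E ->
  (forall z, good_obs s xs th0 z -> 1 <= g z + \int[pi0]_th (v th * sqrt_ratio th z)%:E)%E ->
  (1 <= law_int s Pab xs th0 g +
        \int[pi0]_th (v th * affinity s Pab xs th th0)%:E)%E.
Proof.
move=> mv v0 vS g0 Hg; rewrite -law_int_sqrt_ratio//.
pose f (p : (vec * R) * (vec * (vec * R))) := (v p.1 * sqrt_ratio p.1 p.2)%:E.
have mf : measurable_fun setT f.
  apply/measurable_EFinP; apply: measurable_funM; last exact: measurable_sqrt_ratio.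
  exact: (measurableT_comp mv).
have f0 p : (0 <= f p)%E by rewrite lee_fin mulr_ge0// sqrt_ratio_ge0.
pose H z := (\int[pi0]_th f (th, z))%E.
have mH : measurable_fun setT H by exact: (measurable_integral_fst pi0 mf f0).
have H0 z : (0 <= H z)%E by apply: integral_ge0.
pose k z := maxe (1 - H z)%E 0%E.
have mk : measurable_fun setT k.
  by apply: measurable_maxe => //; apply: emeasurable_funB.
have k0 z : (0 <= k z)%E by rewrite /k le_max lexx orbT.
have kH z : (1 <= k z + H z)%E.
  rewrite /k; move: (H0 z); case: (H z) => [x||] //=.
    move=> x0; rewrite -EFinB; case: (leP (1 - x)%:E 0%E); rewrite -?EFinD lee_fin => H1.
      by rewrite lee_fin; lra.
    by lra.
  by move=> _; rewrite addey// ?leey// gt_eqF// lt_max ltNy0 orbT.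
have kg z : good_obs s xs th0 z -> (k z <= g z)%E.
  move=> gz; rewrite /k ge_max g0 andbT; have := Hg z gz; rewrite -/(H z).
  move: (H0 z) (g0 z); case: (H z) => [x||] //=; case: (g z) => [y||] //=.
  - by move=> _ _; rewrite -EFinD -EFinB !lee_fin; lra.
  - by move=> *; rewrite leey.
  - by move=> *; exact: leNye.
apply: (@le_trans _ _ (law_int s Pab xs th0 k + law_int s Pab xs th0 H)%E); last first.
  by rewrite leeD2r// (le_law_int s_gt0 mxs admissible_ae nongeneric_null xs_opt).
rewrite !(law_intE s_gt0 mxs admissible_ae nongeneric_null xs_opt)//.
have mt (h : vec * (vec * R) -> \bar R) : measurable_fun setT h -> measurable_fun setT
    (fun ab => \sum_c h (vertex c ab, ab) * (pr s xs th0 c ab)%:E)%E.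
  move=> mh; apply: emeasurable_sum => c; apply: emeasurable_funM.
    have m1 : measurable_fun setT (fun ab : vec * R => (vertex c ab, ab)).
      by apply: measurable_fun_pair => //; exact: measurable_vertex.
    exact: (measurableT_comp mh m1).
  apply/measurable_EFinP; exact: (measurable_cut1 th0 (measurable_pr mxs c)).
have t0 (h : vec * (vec * R) -> \bar R) ab : (forall z, 0 <= h z)%E ->
    (0 <= \sum_c h (vertex c ab, ab) * (pr s xs th0 c ab)%:E)%E.
  by move=> h0; apply: sume_ge0 => c _; rewrite mule_ge0// lee_fin pr_ge0.
rewrite -ge0_integralD//; [|by move=> ab _; exact: t0|exact: mt|by move=> ab _; exact: t0|exact: mt].
have {1}<- : (\int[Pab]_ab (cst 1%E ab) = 1 :> \bar R)%E.
  by rewrite integral_cst// mul1e; exact: probability_setT.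
apply: le_lower_integral => // ab _ /=; rewrite -big_split/=.
rewrite -(sum_pr s_gt0 mxs ab Sth0) -sumEFin; apply: lee_sum => c _.
rewrite -ge0_muleDl//; apply: (@le_trans _ _ (1 * (pr s xs th0 c ab)%:E)%E); first by rewrite mul1e.
by apply: lee_wpmul2r => //; rewrite lee_fin pr_ge0.
Qed.

(** The induction is general in the weight [v], which stores the square-root ratios of the
    observations already drawn; averaging over such an observation replaces its ratio by one factor
    of the affinity. *)
Lemma iid_expect_lower_bound T (v : vec * R -> R) (g : seq (vec * (vec * R)) -> \bar R) :
  measurable_fun setT v -> (forall th, 0 <= v th) -> (forall th, v th != 0 -> sphere th.1) ->
  (forall D, 0 <= g D)%E ->
  (forall D, size D = T -> {in D, forall z, good_obs s xs th0 z} ->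
    1 <= g D + \int[pi0]_th (v th * \prod_(z <- D) sqrt_ratio th z)%:E)%E ->
  (1 <= iid_expect (law_int s Pab xs th0) T g +
    \int[pi0]_th (v th * affinity s Pab xs th th0 ^+ T)%:E)%E.
Proof.
have maff := measurable_affinity (Pab := Pab) mxs th0.
elim: T v g => [|T IH] v g mv v0 vS g0 Hg.
  have := Hg [::] erefl; rewrite /= => /(_ _)/le_trans; apply => //.
  by under eq_integral do rewrite big_nil; under [X in (_ <= _ + X)%E]eq_integral do rewrite expr0.
pose w th := v th * affinity s Pab xs th th0 ^+ T.
have mw : measurable_fun setT w by apply: measurable_funM => //; exact: measurable_funX.
have w0 th : 0 <= w th by rewrite mulr_ge0// exprn_ge0// affinity_ge0.
have wS th : w th != 0 -> sphere th.1.
  by rewrite mulf_eq0 negb_or => /andP[/vS].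
under [X in (_ <= _ + X)%E]eq_integral do rewrite exprSr mulrA.
apply: (one_step mw w0 wS) => [z|z gz]; first exact: iid_expect_ge0.
have mr : measurable_fun setT (sqrt_ratio ^~ z) by exact: (measurable_cut2 z measurable_sqrt_ratio).
(* For fixed [z], its ratio joins the weight of the remaining observations. *)
have := IH (fun th => v th * sqrt_ratio th z) (fun D => g (z :: D)).
under [X in (_ -> _ -> _ -> _ -> _ -> _ <= _ + X)%E]eq_integral do rewrite mulrAC.
apply => //.
- exact: measurable_funM.
- by move=> th; rewrite mulr_ge0// sqrt_ratio_ge0.
- by move=> th; rewrite mulf_eq0 negb_or => /andP[/vS].
move=> D sD gD; have := Hg (z :: D); rewrite /= sD => /(_ erefl).
under eq_integral do rewrite big_cons mulrA.
by apply => x; rewrite in_cons => /predU1P[->//|]; exact: gD.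
Qed.

End PosteriorRecursion.
Arguments obs_pr {R n} s xs th z.
Arguments sqrt_ratio {R n} s xs th0 th z.

(** * A deterministic bound of posterior mass by square-root likelihood ratios *)

Section BayesBound.
Context d (X : measurableType d) (R : realType) (mu : {measure set X -> \bar R}).
Variables (A : set X) (lik ratio : X -> R) (x0 : X) (B : X -> set X) (beta K : R).
Hypotheses (mA : measurable A) (muA : (mu A < +oo)%E).
Hypotheses (mlik : measurable_fun setT lik) (lik_ge0 : forall x, 0 <= lik x).
Hypothesis lik_le1 : forall x, A x -> lik x <= 1.
Hypotheses (Ax0 : A x0) (lik_gt0 : 0 < lik x0).
Hypotheses (beta0 : 0 < beta) (K0 : 0 <= K) (mB : forall x, measurable (B x)).
Hypothesis B_mass : forall x, A x -> (beta%:E <= mu (B x `&` A))%E.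
Hypothesis B_lip : forall x y, A x -> A y -> B x y -> lik x <= K * lik y.
Hypotheses (mratio : measurable_fun setT ratio) (ratio_ge0 : forall x, 0 <= ratio x).
Hypothesis ratio_sq : forall x, ratio x ^+ 2 * lik x0 = lik x.

Let likA x : R := lik x * \1_A x.

Let likA_ge0 x : 0 <= likA x. Proof. exact: mulr_ge0. Qed.

Let mlikA : measurable_fun setT likA.
Proof. by apply: measurable_funM => //; exact: measurable_indic. Qed.

Let den : \bar R := (\int[mu]_x (likA x)%:E)%E.

Lemma evidence_fin : (\int[mu]_x (lik x * \1_A x)%:E)%E \is a fin_num.
Proof.
rewrite ge0_fin_numE; last by apply: integral_ge0 => x _; rewrite lee_fin; exact: likA_ge0.
apply: (le_lt_trans _ muA).
have -> : mu A = (\int[mu]_x (\1_A x)%:E)%E by rewrite integral_indic ?setIT.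
apply: le_lower_integral => x _; rewrite lee_fin; first exact: likA_ge0.
rewrite indicE; case: (boolP (x \in A)) => [|_]; last by rewrite mulr0.
by rewrite inE mulr1 => /lik_le1.
Qed.

Let dd := fine den.

Let dE : dd%:E = den. Proof. exact: fineK evidence_fin. Qed.

Let den_ge x : A x -> lik x * beta <= K * dd.
Proof.
move=> Ax; rewrite -lee_fin 2!EFinM dE /den -integral_EFinZl//.
apply: (@le_trans _ _ ((lik x)%:E * mu (B x `&` A))%E).
  by apply: lee_wpmul2l; [rewrite lee_fin|exact: B_mass].
have mBD : measurable (B x `&` A) by apply: measurableI.
have -> : mu (B x `&` A) = (\int[mu]_y (\1_(B x `&` A) y)%:E)%E by rewrite integral_indic ?setIT.
rewrite -integral_EFinZl//.
apply: le_lower_integral => y _; rewrite lee_fin; first by rewrite mulr_ge0.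
rewrite {1}indicE; case: (boolP (y \in _)) => [|_]; last first.
  by rewrite mulr0 mulr_ge0// likA_ge0.
rewrite inE => -[Bxy Ay]; rewrite /likA indicE mem_set// !mulr1.
exact: B_lip.
Qed.

Lemma evidence_gt0 : 0 < fine (\int[mu]_x (lik x * \1_A x)%:E)%E.
Proof.
rewrite -/likA -/den -/dd.
have E0 : 0 < K * dd by apply: lt_le_trans (den_ge Ax0); rewrite mulr_gt0.
have : 0 <= dd.
  by apply: fine_ge0; apply: integral_ge0 => x _; rewrite lee_fin; exact: likA_ge0.
rewrite le_eqVlt => /predU1P[d0|//].
by rewrite -d0 mulr0 ltxx in E0.
Qed.

Let C := K / beta.

Let lik_le x : A x -> lik x <= C * dd.
Proof. by move=> Ax; rewrite /C mulrAC ler_pdivlMr// den_ge. Qed.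

(* [lik x ^ 2 = ratio x ^ 2 * lik x0 * lik x], and both likelihoods are at most [C * dd]. *)
Let lik_le_ratio x : A x -> lik x <= C * dd * ratio x.
Proof.
move=> Ax; have C0 : 0 <= C * dd by apply: (le_trans (lik_ge0 x)); exact: lik_le.
have H : lik x ^+ 2 <= (C * dd * ratio x) ^+ 2.
  rewrite exprMn expr2 -{2}(ratio_sq x) mulrCA [leRHS]mulrC; apply: ler_wpM2l; first exact: sqr_ge0.
  by rewrite expr2; apply: ler_pM => //; exact: lik_le.
by move: H; rewrite ler_pXn2r ?nnegrE ?(mulr_ge0 C0 (ratio_ge0 x)) ?lik_ge0.
Qed.

(** The bound on the posterior mass of [E], multiplied by the evidence; the last integral may be
    infinite. *)
Lemma bayes_bound (E : set X) : measurable E ->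
  (\int[mu]_x (lik x * (\1_E x * \1_A x))%:E <=
   (fine (\int[mu]_x (lik x * \1_A x)%:E))%:E *
   \int[mu]_x (K / beta * (\1_E x * \1_A x) * ratio x)%:E)%E.
Proof.
move=> mE; have d0 := evidence_gt0; rewrite -/likA -/den -/dd in d0 *.
have C0 : 0 <= C by rewrite divr_ge0// ltW.
have mEA : measurable_fun setT (fun x => \1_E x * \1_A x : R).
  by apply: measurable_funM; exact: measurable_indic.
have mI : measurable_fun setT (fun x => K / beta * (\1_E x * \1_A x) * ratio x).
  by apply: measurable_funM => //; exact: measurable_funM.
have I0 x : 0 <= K / beta * (\1_E x * \1_A x) * ratio x.
  by apply: mulr_ge0 => //; apply: mulr_ge0 => //; exact: mulr_ge0.
rewrite -(integral_EFinZl mu (ltW d0) mI I0).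
apply: le_lower_integral => x _; rewrite lee_fin; first by rewrite !mulr_ge0.
rewrite [leRHS](_ : _ = C * dd * ratio x * (\1_E x * \1_A x)); last by rewrite /C; ring.
have [Ax|Ax] := pselect (A x); last by rewrite [\1_A x]indicE memNset// !mulr0.
by apply: ler_wpM2r; [rewrite mulr_ge0|exact: lik_le_ratio].
Qed.

End BayesBound.

(** * The posterior of a fixed dataset *)

Section Posterior.
Context {R : realType} {n : nat}.
Local Notation vec := (n.-tuple R).
Context {s : {finite_measure set vec -> \bar R}} {xs : vec -> vec * R -> vec}.
Hypothesis s_gt0 : (0 < s sphere)%E.
Hypothesis mxs : measurable_fun setT (fun p : vec * (vec * R) => xs p.1 p.2).
Hypothesis nongeneric_null : forall a : vec, (forall i, 0 < tnth a i) ->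
  {ae s, forall u, generic u a}.
Hypothesis xs_opt : forall u (ab : vec * R), admissible ab -> LP_optimal u ab.1 ab.2 (xs u ab).
Context {klo khi : R}.

Definition param_dom : set (vec * R) := [set th | sphere th.1 /\ klo < th.2 < khi].

Let I := [set k : R | klo < k < khi].

Let measurable_I : measurable I.
Proof.
rewrite (_ : I = `]klo, khi[%classic) ?measurable_itv//.
Qed.

Lemma measurable_param_dom : measurable param_dom.
Proof.
rewrite (_ : param_dom = sphere `*` I); first by apply: measurableX;
  [exact: measurable_sphere|exact: measurable_I].
by apply/seteqP; split => th.
Qed.

(** Turns the iterated integrals of [posterior_mass] into integrals against one finite measure. It
    is left unnormalized, the constant cancelling in the posterior. *)
Lemma exists_prior : exists prior : {finite_measure set (vec * R)%type -> \bar R},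
  (forall f : vec * R -> \bar R, measurable_fun setT f -> (forall th, 0 <= f th)%E ->
    (\int[s]_(m in sphere) \int[lebesgue_measure]_(k in I) f (m, k) =
     \int[prior]_th (f th * (\1_param_dom th)%:E))%E) /\
  (forall (A : set vec) (J : set R), measurable A -> measurable J ->
    prior ((A `*` J) `&` param_dom) = (s (A `&` sphere) * lebesgue_measure (J `&` I))%E).
Proof.
have mDom := measurable_param_dom.
have [mu muE] : exists m : {measure set (vec * measurableTypeR R)%type -> \bar R},
    forall A, m A = (s \x (@lebesgue_measure R))%E A.
  by exists (s \x (@lebesgue_measure R))%E.
(* Lebesgue measure lives on the copy [measurableTypeR R] of the line; the product is carried to
   [vec * R] along the identity. *)
have mid : measurable_fun setT (id : vec * measurableTypeR R -> vec * R).
  exact: measurable_id.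
have mind : measurable_fun setT (\1_param_dom : vec * measurableTypeR R -> R).
  exact: measurable_indic.
have rectE (A : set vec) (J : set R) :
    (A `*` J) `&` param_dom = (A `&` sphere) `*` (J `&` I).
  by apply/seteqP; split => th; [move=> [[? ?] [? ?]]|move=> [[? ?] [? ?]]].
have rect (A : set vec) (J : set R) : measurable A -> measurable J ->
    mu ((A `*` J) `&` param_dom) = (s (A `&` sphere) * lebesgue_measure (J `&` I))%E.
  move=> mA mJ; rewrite muE rectE; apply: product_measure1E; last exact: measurableI.
  by apply: measurableI => //; exact: measurable_sphere.
have mudom : (mu param_dom < +oo)%E.
  have -> : mu param_dom = mu ((setT `*` setT) `&` param_dom) by rewrite setXTT setTI.
  rewrite rect// !setTI lte_mul_pinfty//; first by apply: fin_num_measure; exact: measurable_sphere.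
  have -> : I = `]klo, khi[%classic by apply/seteqP; split => x /=; rewrite in_itv.
  by rewrite lebesgue_measure_itv /=; case: ifP => _; rewrite ?ltry// -EFinB ltry.
have mDom' : measurable (param_dom : set (vec * measurableTypeR R)) by exact: mDom.
pose mu' := mfrestr mDom' mudom.
have [nu [nuE nuint]] := exists_pushforward mu' mid.
have nuT : (nu setT < +oo)%E by rewrite nuE /= /mfrestr /mrestr preimage_setT setTI.
have [pi0 piE] := exists_finite_measure nuT.
exists pi0; split; last first.
  move=> A J mA mJ; rewrite -rect// [LHS]piE nuE /= /mfrestr /mrestr.
  by rewrite -setIA setIid.
move=> f mf f0.
pose h th := (f th * (\1_param_dom th)%:E)%E.
have mh : measurable_fun setT h.
  apply: emeasurable_funM => //; apply/measurable_EFinP; exact: measurable_indic.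
have h0 th : (0 <= h th)%E by rewrite mule_ge0// lee_fin.
have hE (mm : {measure set (vec * measurableTypeR R)%type -> \bar R}) :
    (\int[mm]_th h th = \int[mm]_(th in param_dom) f th)%E.
  rewrite [RHS]integral_mkcond; apply: eq_integral => th _.
  by rewrite patchE /h indicE; case: ifPn => _; rewrite ?mule1 ?mule0.
transitivity (\int[mu']_th h th)%E; last first.
  rewrite -(nuint h mh h0); apply: eq_measure_integral => A mA _.
  by rewrite [RHS]piE.
transitivity (\int[mu]_th h th)%E; last first.
  rewrite !hE; apply: eq_measure_integral => A mA Adom.
  by rewrite /= /mfrestr /mrestr setIidl.
transitivity (\int[(s \x (@lebesgue_measure R))%E]_th h th)%E; last first.
  by apply: eq_measure_integral => A mA _; rewrite muE.
rewrite fubini_tonelli1//; rewrite integral_mkcond; apply: eq_integral => m _.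
rewrite patchE /fubini_F /h; case: ifPn => [|].
  rewrite inE => Sm; rewrite [LHS]integral_mkcond; apply: eq_integral => k _.
  rewrite patchE indicE; case: ifPn => [|].
    by rewrite inE => Ik; rewrite mem_set ?mule1.
  by rewrite notin_setE => Ik; rewrite memNset ?mule0// => -[].
rewrite notin_setE => Sm; symmetry; apply: integral0_eq => k _.
by rewrite indicE memNset ?mule0// => -[].
Qed.

Context {prior : {sigma_finite_measure set (vec * R)%type -> \bar R}}.
Hypothesis prior_integral : forall f : vec * R -> \bar R,
  measurable_fun setT f -> (forall th, 0 <= f th)%E ->
  (\int[s]_(m in sphere) \int[lebesgue_measure]_(k in [set k : R | (klo < k < khi)%R]) f (m, k) =
   \int[prior]_th (f th * (\1_param_dom th)%:E))%E.

Context {th0 : vec * R} {T : nat} {beta e1 : R} {B : vec * R -> set (vec * R)}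
  {G Theta : set (vec * R)} {D : seq (vec * (vec * R))}.
Hypothesis th0_dom : param_dom th0.
Hypotheses (beta0 : 0 < beta) (e10 : 0 <= e1).
Hypothesis mB : forall th, measurable (B th).
Hypothesis B_mass : forall th, param_dom th -> (beta%:E <= prior (B th `&` param_dom))%E.
Hypothesis B_lip : forall th th', param_dom th -> param_dom th' -> B th th' ->
  forall c ab, pr s xs th c ab <= e1 * pr s xs th' c ab.
Hypothesis dom_fin : (prior param_dom < +oo)%E.
Hypotheses (mG : measurable G) (GTheta : param_dom `&` G `<=` Theta).
Hypotheses (sD : size D = T) (gD : {in D, forall z, good_obs s xs th0 z}).

Let lik (th : vec * R) : R := \prod_(z <- D) obs_pr s xs th z.

Let lik_ge0 th : 0 <= lik th.
Proof. by apply: prodr_ge0 => z _; exact: obs_pr_ge0. Qed.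

Let lik_gt0 : 0 < lik th0.
Proof.
rewrite /lik big_seq; apply: prodr_gt0 => z zD.
by have [u [_ _ _ _]] := gD zD.
Qed.

Let lik_le1 th : param_dom th -> lik th <= 1.
Proof.
move=> [Sth _]; rewrite /lik; elim: (D : seq _) => [|z D' IH]; first by rewrite big_nil.
rewrite big_cons; apply: mulr_ile1; [exact: obs_pr_ge0| |exact: obs_pr_le1|exact: IH].
by apply: prodr_ge0 => y _; exact: obs_pr_ge0.
Qed.

Let likE th : sphere th.1 -> likelihood s D th = lik th.
Proof.
move=> Sth; rewrite /likelihood /lik !big_seq; apply: eq_bigr => z zD.
exact: (likelihood_factor mxs nongeneric_null xs_opt Sth (gD zD)).
Qed.

Let measurable_lik : measurable_fun setT lik.
Proof.
apply: measurable_prod => z _.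
exact: (measurable_cut2 z (measurable_obs_pr mxs)).
Qed.

Let lik_lip th th' : param_dom th -> param_dom th' -> B th th' ->
  lik th <= e1 ^+ T * lik th'.
Proof.
move=> dth dth' Bth; rewrite /lik -sD; apply: ler_prod_scale => z; first exact: obs_pr_ge0.
exact: (B_lip dth dth' Bth).
Qed.

Let ratio th := \prod_(z <- D) sqrt_ratio s xs th0 th z.

Let ratio_ge0 th : 0 <= ratio th.
Proof. by apply: prodr_ge0 => z _; exact: sqrt_ratio_ge0. Qed.

Let ratio_sq th : ratio th ^+ 2 * lik th0 = lik th.
Proof.
rewrite /ratio /lik -prodrXl -big_split/= !big_seq; apply: eq_bigr => z zD.
have z0 : 0 < obs_pr s xs th0 z by have [u [_ _ _ _]] := gD zD.
rewrite /sqrt_ratio sqr_sqrtr; last exact: divr_ge0 (obs_pr_ge0 th z) (ltW z0).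
by rewrite divfK// gt_eqF.
Qed.

Let mratio : measurable_fun setT ratio.
Proof.
apply: measurable_prod => z _.
exact: (measurable_cut2 z (measurable_sqrt_ratio mxs)).
Qed.

(** The evidence splits over [G] and its complement. The first part is at most the numerator, by
    monotonicity of both nested lower integrals; the second is controlled by [bayes_bound]. Division
    by the evidence, positive and finite, concludes. *)
Lemma posterior_lower_bound :
  (1 <= (posterior_mass s klo khi D Theta)%:E +
    \int[prior]_th (e1 ^+ T / beta * (\1_(~` G) th * \1_param_dom th) *
      \prod_(z <- D) sqrt_ratio s xs th0 th z)%:E)%E.
Proof.
have mDom := measurable_param_dom.
have [fin_den den_gt0 bayes] :
    [/\ (\int[prior]_th (lik th * \1_param_dom th)%:E)%E \is a fin_num,
      0 < fine (\int[prior]_th (lik th * \1_param_dom th)%:E)%E &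
      (\int[prior]_th (lik th * (\1_(~` G) th * \1_param_dom th))%:E <=
      (fine (\int[prior]_th (lik th * \1_param_dom th)%:E))%:E *
      \int[prior]_th (e1 ^+ T / beta * (\1_(~` G) th * \1_param_dom th) * ratio th)%:E)%E].
  have K0 : 0 <= e1 ^+ T by exact: exprn_ge0.
  split; first exact: (evidence_fin mDom dom_fin lik_ge0 lik_le1).
    exact: (evidence_gt0 mDom dom_fin measurable_lik lik_ge0 lik_le1 th0_dom lik_gt0
      beta0 K0 mB B_mass lik_lip).
  apply: (bayes_bound mDom dom_fin measurable_lik lik_ge0 lik_le1 th0_dom lik_gt0
    beta0 K0 mB B_mass lik_lip mratio ratio_ge0 ratio_sq).
  exact: measurableC.
rewrite -/(ratio _).
move: (measurable_lik) (lik_ge0) (likE) fin_den den_gt0 bayes.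
move: (lik) => L mL L0 LE fin_den den_gt0 bayes.
pose num := (\int[s]_(m in sphere) \int[lebesgue_measure]_(k in I)
  (\1_Theta (m, k) * likelihood s D (m, k))%:E)%E.
set den := (\int[prior]_th (L th * \1_param_dom th)%:E)%E in fin_den den_gt0 bayes.
have denE : (\int[s]_(m in sphere) \int[lebesgue_measure]_(k in I)
    (likelihood s D (m, k))%:E)%E = den.
  transitivity (\int[s]_(m in sphere) \int[lebesgue_measure]_(k in I) (L (m, k))%:E)%E.
    by apply: eq_integral => m /[!inE] Sm; apply: eq_integral => k _; rewrite LE.
  rewrite (prior_integral (f := fun th => (L th)%:E)).
  - by apply: eq_integral => th _; rewrite -EFinM.
  - exact/measurable_EFinP.
  - by move=> th; rewrite lee_fin.
have num_le : (num <= den)%E.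
  rewrite -denE; apply: le_lower_integral => m Sm.
    by apply: integral_ge0 => k _; rewrite lee_fin LE// mulr_ge0.
  apply: le_lower_integral => k _; rewrite lee_fin LE// ?mulr_ge0//.
  by rewrite ler_piMl// indicE lern1 leq_b1.
set e := (\int[prior]_th (L th * (\1_(~` G) th * \1_param_dom th))%:E)%E in bayes.
have num_ge : (den <= num + e)%E.
  have H : (\int[prior]_th (L th * (\1_G th * \1_param_dom th))%:E <= num)%E.
    rewrite (eq_integral (fun th => (L th * \1_G th)%:E * (\1_param_dom th)%:E))%E; last first.
      by move=> th _; rewrite -EFinM mulrA.
    rewrite -(prior_integral (f := fun th => (L th * \1_G th)%:E)).
    - apply: le_lower_integral => m Sm.
        by apply: integral_ge0 => k _; rewrite lee_fin mulr_ge0.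
      apply: le_lower_integral => k Ik; rewrite lee_fin ?mulr_ge0//.
      rewrite LE// mulrC; apply: ler_wpM2r => //; rewrite !indicE ler_nat.
      case: (boolP ((m, k) \in G)) => // /[!inE] Gmk.
      by rewrite mem_set//; apply: GTheta.
    - by apply/measurable_EFinP; apply: measurable_funM => //; exact: measurable_indic.
    - by move=> th; rewrite lee_fin mulr_ge0.
  have mi (F : set (vec * R)) : measurable F ->
      measurable_fun setT (fun th => (L th * (\1_F th * \1_param_dom th))%:E).
    move=> mF; apply/measurable_EFinP; apply: measurable_funM => //.
    by apply: measurable_funM; exact: measurable_indic.
  apply: le_trans (leeD2r e H); rewrite /e -ge0_integralD//.
  - apply: le_lower_integral => th _; first by rewrite lee_fin mulr_ge0.
    rewrite -EFinD lee_fin -mulrDr; apply: ler_wpM2l => //; rewrite -mulrDl.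
    apply: ler_peMl => //; rewrite !indicE in_setC.
    by case: (th \in G); rewrite ?addr0 ?add0r.
  - by move=> th _; rewrite lee_fin !mulr_ge0.
  - exact: mi.
  - by move=> th _; rewrite lee_fin !mulr_ge0.
  - by apply: mi; exact: measurableC.
set X := (X in (_ <= _ + X)%E); rewrite -/X in bayes.
have C0 : 0 <= e1 ^+ T / beta by rewrite divr_ge0 ?exprn_ge0 ?(ltW beta0).
have X0 : (0 <= X)%E.
  apply: integral_ge0 => th _; rewrite lee_fin; apply: mulr_ge0; last exact: ratio_ge0.
  by apply: (mulr_ge0 C0); exact: mulr_ge0.
have num0 : (0 <= num)%E.
  apply: integral_ge0 => m Sm; apply: integral_ge0 => k _.
  by rewrite lee_fin LE// mulr_ge0.
have num_fin : num \is a fin_num.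
  by rewrite ge0_fin_numE//; apply: (le_lt_trans num_le); rewrite -ge0_fin_numE// (le_trans num0).
rewrite /posterior_mass -/num denE.
have {}num_ge := le_trans num_ge (leeD2l num bayes).
move: num_ge X0; rewrite -{1}(fineK fin_den) -{1}(fineK num_fin).
move: den_gt0; move: (fine den) (fine num) => dd nn dd0; case: X {bayes} => [x||] //.
  rewrite -!EFinM -!EFinD !lee_fin => H x0.
  by rewrite -(ler_pM2r dd0) mul1r mulrDl divfK ?gt_eqF// [x * dd]mulrC.
by move=> _ _; rewrite addey// leey.
Qed.

End Posterior.
Arguments param_dom {R n} klo khi _.

(** * The exponential beats the prior ratio *)

Section Numerics.
Context {R : realType}.

Lemma ln2_ge_half : 1 / 2 <= ln 2 :> R.
Proof.
rewrite -ler_expR lnK ?posrE//.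
have := expR_ge1Dx (- (1 / 2) : R); rewrite expRN => H.
have e0 : 0 < expR (1 / 2 : R) by exact: expR_gt0.
have : (1 + - (1 / 2)) * expR (1 / 2 : R) <= 1.
  by apply: (le_trans (ler_wpM2r (ltW e0) H)); rewrite mulVf// gt_eqF.
lra.
Qed.

Lemma ler_expR_pow (k : nat) (x : R) : 2 ^+ k <= x -> k%:R / 2 <= ln x.
Proof.
move=> kx; have x0 : 0 < x by apply: lt_le_trans kx; rewrite exprn_gt0.
apply: (@le_trans _ _ (ln (2 ^+ k))); last by rewrite ler_ln ?posrE ?exprn_gt0.
have -> : ln (2 ^+ k) = k%:R * ln 2 :> R by rewrite lnXn// mulr_natl.
apply: ler_wpM2l => //.
by have := ln2_ge_half; lra.
Qed.

(* [n], [T], [M] and the constants are majorized by exponentials, after which only the exponents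
   are compared. *)
Lemma prior_ratio_bound (n T : nat) (M : R) : (0 < n)%N -> (1 < T)%N -> 1 <= M ->
  32 * M ^+ 2 * n%:R * ln T%:R ^+ 2 <= T%:R ->
  expR 2 * (40 * n%:R ^+ 2 * M * T%:R) ^+ n * (2 * n%:R * M ^+ 2 * T%:R) *
    expR (- (32 * M ^+ 2 * n%:R * ln T%:R ^+ 2)) <= T%:R^-1.
Proof.
move=> n0 T1 M1 H.
have n1 : 1 <= n%:R :> R by rewrite ler1n.
have T0 : 0 < T%:R :> R by rewrite ltr0n ltnW.
set L := ln T%:R in H *.
have L2 : 1 / 2 <= L by have := @ler_expR_pow 1 T%:R; rewrite expr1; apply; rewrite ler_nat.
have M21 : 1 <= M ^+ 2 by rewrite expr2; nra.
(* A bootstrap: [L >= 1/2] and the hypothesis force [T >= 8], which in turn gives [L >= 1]. *)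
have T8 : 8 <= T%:R :> R.
  apply: le_trans H; have L4 : 1 / 4 <= L ^+ 2 by rewrite expr2; nra.
  have : 1 <= M ^+ 2 * n%:R by nra.
  have -> : 32 * M ^+ 2 * n%:R * L ^+ 2 = 32 * (M ^+ 2 * n%:R * L ^+ 2) by ring.
  move: (M ^+ 2 * n%:R) (L ^+ 2) L4 => y z L4 y1; nra.
have L1 : 1 <= L.
  have : 3%:R / 2 <= L by apply: ler_expR_pow; apply: le_trans T8; lra.
  lra.
have L21 : L <= L ^+ 2 by rewrite expr2; nra.
have nT : n%:R <= T%:R :> R.
  apply: le_trans H; have : 1 <= M ^+ 2 * L ^+ 2 by nra.
  by move: (M ^+ 2) (L ^+ 2) M21 L21 => y z y1 z1 yz; nra.
have eT : expR L = T%:R by rewrite lnK// posrE.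
have eM : M <= expR M by have := expR_ge1Dx M; lra.
have e1 : 2 <= expR 1 :> R by have := expR_ge1Dx (1 : R); lra.
have e6 : 40 <= expR 6 :> R.
  rewrite -[6]mulr1 expRM_natl.
  apply: (@le_trans _ _ (2 ^+ 6)); first by lra.
  by rewrite ler_pXn2r// nnegrE ?expR_ge0.
have S1 : 40 * n%:R ^+ 2 * M * T%:R <= expR (6 + 3 * L + M).
  have -> : expR (6 + 3 * L + M) = expR 6 * T%:R ^+ 2 * expR M * T%:R.
    rewrite -eT -expRM_natl -!expRD; congr expR; lra.
  have n20 : 0 <= n%:R ^+ 2 :> R by exact: sqr_ge0.
  rewrite ler_pM2r//; apply: ler_pM; [by rewrite mulr_ge0|by lra| |exact: eM].
  by apply: ler_pM => //; rewrite ler_pXn2r ?nnegrE ?ler0n.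
have S2 : 2 * n%:R * M ^+ 2 * T%:R <= expR (1 + 2 * L + 2 * M).
  have -> : expR (1 + 2 * L + 2 * M) = expR 1 * T%:R * expR M ^+ 2 * T%:R.
    rewrite -eT -[expR M ^+ 2]expRM_natl -!expRD; congr expR; lra.
  have Mp : 0 <= M by lra.
  rewrite ler_pM2r//; apply: ler_pM; [by rewrite mulr_ge0|by rewrite exprn_ge0| |].
    by apply: ler_pM.
  by rewrite ler_pXn2r ?nnegrE ?expR_ge0.
have M0 : 0 <= M by lra.
have P0 : 0 <= 40 * n%:R ^+ 2 * M * T%:R by rewrite !mulr_ge0 ?ler0n ?sqr_ge0.
have P1 : 0 <= 2 * n%:R * M ^+ 2 * T%:R by rewrite !mulr_ge0 ?ler0n ?sqr_ge0.
have S1n : (40 * n%:R ^+ 2 * M * T%:R) ^+ n <= expR (n%:R * (6 + 3 * L + M)).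
  by rewrite expRM_natl ler_pXn2r ?nnegrE ?expR_ge0.
rewrite -eT -expRN.
apply: (@le_trans _ _ (expR 2 * expR (n%:R * (6 + 3 * L + M)) * expR (1 + 2 * L + 2 * M) *
    expR (- (32 * M ^+ 2 * n%:R * L ^+ 2)))).
  rewrite eT ler_wpM2r ?expR_ge0//; apply: ler_pM => //.
    by rewrite mulr_ge0 ?expR_ge0// exprn_ge0.
  by rewrite ler_wpM2l ?expR_ge0.
rewrite -!expRD ler_expR.
set N := n%:R in n1 *; set y := M ^+ 2 in M21 *; set z := L ^+ 2 in L21 *.
have My : M <= y by rewrite /y expr2; nra.
(* Every term of the exponent is at most a multiple of [N * (y * z)]; the coefficients, with [L]
   from the right-hand side, add up to 18, below the available 32. *)
have yz : 1 <= y * z by nra.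
have q1 : 1 <= N * (y * z) by nra.
have q2 : N <= N * (y * z) by nra.
have q3 : N * L <= N * (y * z) by rewrite ler_pM2l; [nra|lra].
have q4 : N * M <= N * (y * z) by rewrite ler_pM2l; [nra|lra].
have q5 : L <= N * (y * z) by nra.
have q6 : M <= N * (y * z) by nra.
have -> : 32 * y * N * z = 32 * (N * (y * z)) by ring.
have -> : N * (6 + 3 * L + M) = 6 * N + 3 * (N * L) + N * M by ring.
lra.
Qed.

End Numerics.

(** * Expected posterior mass near the true parameter *)

Section Concentration.
Context {R : realType} {n : nat}.
Local Notation vec := (n.-tuple R).
Context {s : {finite_measure set vec -> \bar R}} {Pab : probability (vec * R)%type R}
  {xs : vec -> vec * R -> vec}.
Hypothesis s_gt0 : (0 < s sphere)%E.
Hypothesis mxs : measurable_fun setT (fun p : vec * (vec * R) => xs p.1 p.2).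
Hypothesis admissible_ae : {ae Pab, forall ab, admissible ab}.
Hypothesis nongeneric_null : forall a : vec, (forall i, 0 < tnth a i) ->
  {ae s, forall u, generic u a}.
Hypothesis xs_opt : forall u (ab : vec * R), admissible ab -> LP_optimal u ab.1 ab.2 (xs u ab).
Hypothesis s_cap : forall (m : vec) (d : R), sphere m -> 0 < d <= 1 ->
  ((n%:R * (d / (10 * n%:R)) ^+ n)%:E <=
    s ([set u | forall i, (`|tnth u i - tnth m i| <= d)%R] `&` sphere))%E.
Hypothesis s_sphere : (s sphere <= (n%:R * 2 ^+ n)%:E)%E.
Context {klo khi : R}.
Hypotheses (klo0 : 0 < klo) (kk : klo < khi).

Lemma posterior_mass_ge0 (D : seq (vec * (vec * R))) Theta :
  0 <= posterior_mass s klo khi D Theta.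
Proof.
have lik0 th : 0 <= likelihood s D th.
  apply: prodr_ge0 => z _; apply: fine_ge0; apply: integral_ge0 => u _.
  by rewrite lee_fin divr_ge0 ?expR_ge0 ?vmf_norm_ge0.
rewrite /posterior_mass; apply: divr_ge0; apply: fine_ge0.
  apply: integral_ge0 => m _; apply: integral_ge0 => k _; rewrite lee_fin.
  by apply: mulr_ge0.
by apply: integral_ge0 => m _; apply: integral_ge0 => k _; rewrite lee_fin.
Qed.

Let I := [set k : R | klo < k < khi].

(** Near an endpoint of the parameter interval part of the ball is cut off, but the interval on the
    other side of [k] compensates; hence radius rather than diameter. *)
Lemma lebesgue_near_ge (k d : R) : klo < k < khi -> 0 < d ->
  ((Num.min d (khi - klo))%:E <= lebesgue_measure ([set k' | (`|k' - k| <= d)%R] `&` I))%E.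
Proof.
move=> /andP[k1 k2] d0.
pose lo := Num.max klo (k - d); pose hi := Num.min khi (k + d).
have lohi : Num.min d (khi - klo) <= hi - lo.
  rewrite /lo /hi; case: (leP klo (k - d)) => ?; case: (leP khi (k + d)) => ?;
    case: (leP d (khi - klo)) => ?; lra.
have mn0 : 0 < Num.min d (khi - klo) by rewrite lt_min d0 subr_gt0.
apply: (@le_trans _ _ (lebesgue_measure `]lo, hi[%classic)).
  by rewrite lebesgue_measure_itv /= lte_fin ifT -?EFinB ?lee_fin//; lra.
apply: le_measure; rewrite ?inE; first exact: measurable_itv.
  rewrite (_ : _ `&` _ = `[k - d, k + d]%classic `&` `]klo, khi[%classic).
    by apply: measurableI; exact: measurable_itv.
  by apply/seteqP; split => x /=; rewrite !in_itv /= ler_distl.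
move=> x /=; rewrite in_itv /= gt_max lt_min => /andP[/andP[x1 x2] /andP[x3 x4]].
by split; [rewrite ler_distl (ltW x2) (ltW x4)|rewrite /I /= x1 x3].
Qed.

(** The exponent [kappa mu . u] moves by at most [d] through [kappa] and [M n d] through [mu],
    together at most [2 n M d]. *)
Lemma pr_near_le (M d : R) (th th' : vec * R) c (ab : vec * R) : 1 <= M -> khi <= M ->
  param_dom klo khi th -> param_dom klo khi th' ->
  (forall i, `|tnth th'.1 i - tnth th.1 i| <= d) -> `|th'.2 - th.2| <= d ->
  pr s xs th c ab <= expR (2 * (2 * n%:R * M * d)) * pr s xs th' c ab.
Proof.
move=> M1 kM [Sth /andP[k1 k2]] [Sth' /andP[k1' k2']] md kd.
apply: (pr_lipschitz s_gt0 mxs c ab Sth Sth') => u Su.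
have n1 : 1 <= n%:R :> R.
  rewrite ler1n lt0n; apply/eqP => n0; move: Su; rewrite /sphere/= /dotp.
  rewrite big1 => [/eqP|i _]; first by rewrite eq_sym oner_eq0.
  by have := ltn_ord i; rewrite [X in (_ < X)%N]n0.
have d0 : 0 <= d by apply: le_trans kd.
have E : th.2 * dotp th.1 u - th'.2 * dotp th'.1 u =
    - ((th'.2 - th.2) * dotp th.1 u + th'.2 * (dotp th'.1 u - dotp th.1 u)) by ring.
rewrite E normrN; apply: le_trans (ler_normD _ _) _; rewrite !normrM.
have a1 : `|th'.2 - th.2| * `|dotp th.1 u| <= d * 1.
  by apply: ler_pM => //; exact: sphere_dotp_le1.
have a2 : `|th'.2| * `|dotp th'.1 u - dotp th.1 u| <= M * (n%:R * d).
  apply: ler_pM => //; first by rewrite gtr0_norm ?(lt_trans klo0 k1')//; exact: le_trans (ltW k2') kM.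
  exact: dotp_dist_le.
have a3 : d <= M * (n%:R * d).
  by rewrite mulrA ler_peMl// -[leLHS]mulr1; apply: ler_pM.
apply: (le_trans (lerD a1 a2)); rewrite mulr1; lra.
Qed.

Context {mstar : vec} {kstar : R} {T : nat}.
Hypotheses (Smstar : sphere mstar) (kstar_in : klo < kstar < khi) (T1 : (1 < T)%N).

Lemma expected_posterior_bound (Theta : set (vec * R)) (M : R) : 1 <= M -> khi <= M ->
  param_dom klo khi `&` [set th | 1 - affinity s Pab xs th (mstar, kstar) <
    32 * M ^+ 2 * n%:R * ln T%:R ^+ 2 / T%:R] `<=` Theta ->
  (1 <= iid_expect (law_int s Pab xs (mstar, kstar)) T
    (fun D => (posterior_mass s klo khi D Theta)%:E) + (T%:R^-1)%:E)%E.
Proof.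
move=> M1 kM GTheta; set th0 := (mstar, kstar) in GTheta *.
have n0 : (0 < n)%N.
  rewrite lt0n; apply/eqP => n0; move: Smstar; rewrite /sphere/= /dotp.
  rewrite big1 => [/eqP|i _]; first by rewrite eq_sym oner_eq0.
  by have := ltn_ord i; rewrite [X in (_ < X)%N]n0.
have n1 : 1 <= n%:R :> R by rewrite ler1n.
have Tge : 1 <= T%:R :> R by rewrite ler1n ltnW.
set eta := 32 * M ^+ 2 * n%:R * ln T%:R ^+ 2 / T%:R in GTheta *.
set G := [set th | _ < eta] in GTheta *.
have maff : measurable_fun setT (fun th => affinity s Pab xs th th0).
  exact: measurable_affinity.
have mG : measurable G by apply: measurable_ltfun => //; exact: measurable_funB.
have mDom : measurable (param_dom klo khi : set (vec * R)) by exact: measurable_param_dom.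
have [pi0 [pint prect]] := exists_prior (s := s) (klo := klo) (khi := khi).
have dom_fin : (pi0 (param_dom klo khi) < +oo)%E by rewrite ltey_eq fin_num_measure.
(* With this radius one factor of the likelihood changes by at most [exp (2 / T)], hence the whole
   likelihood by at most [exp 2]. *)
pose d := (2 * n%:R * M * T%:R)^-1.
have nMT : 1 <= n%:R * M * T%:R.
  by rewrite -[leLHS]mulr1 -[X in X * _]mulr1; do 2 apply: ler_pM => //; lra.
have d0 : 0 < d by rewrite invr_gt0; lra.
have d1 : d <= 1 by rewrite invf_le1; lra.
have dE : 2 * n%:R * M * d = T%:R^-1 by rewrite /d; field; rewrite !gt_eqF//; lra.
pose cap (m : vec) := [set u : vec | forall i, `|tnth u i - tnth m i| <= d].
pose J (k : R) := [set k' : R | `|k' - k| <= d].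
have mcap m : measurable (cap m).
  rewrite (_ : cap m = [set x | forall i, tnth [tuple tnth m i - d | i < n] i <= tnth x i
     <= tnth [tuple tnth m i + d | i < n] i]); first exact: measurable_tbox.
  by apply/seteqP; split => x /= H i; have := H i; rewrite !tnth_mktuple ler_distl.
have mJ k : measurable (J k).
  rewrite (_ : J k = `[k - d, k + d]%classic); first exact: measurable_itv.
  by apply/seteqP; split => x; rewrite /J /= in_itv /= ler_distl.
pose B (th : vec * R) : set (vec * R) := cap th.1 `*` J th.2.
have mB th : measurable (B th) by exact: measurableX.
pose mn := Num.min d (khi - klo).
have mn0 : 0 < mn by rewrite lt_min d0 subr_gt0.
pose beta := n%:R * (d / (10 * n%:R)) ^+ n * mn.
have n10 : 0 < (10 * n%:R : R) by lra.
have cap0 : 0 < n%:R * (d / (10 * n%:R)) ^+ n :> R.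
  by rewrite mulr_gt0 ?exprn_gt0 ?divr_gt0//; lra.
have beta0 : 0 < beta by exact: mulr_gt0.
have B_mass th : param_dom klo khi th -> (beta%:E <= pi0 (B th `&` param_dom klo khi))%E.
  move=> [Sth kth]; rewrite prect// /beta EFinM; apply: lee_pmul;
    rewrite ?lee_fin ?(ltW mn0) ?(ltW cap0)//.
    by apply: s_cap => //; rewrite d0.
  exact: lebesgue_near_ge.
pose e1 := expR (2 * T%:R^-1) : R.
have B_lip (th th' : vec * R) : param_dom klo khi th -> param_dom klo khi th' -> B th th' ->
    forall c ab, pr s xs th c ab <= e1 * pr s xs th' c ab.
  move=> dth dth' [md kd] c ab; rewrite /e1 -dE; exact: pr_near_le.
have th0_dom : param_dom klo khi th0 by split.
have aff0 th : 0 <= affinity s Pab xs th th0 by exact: affinity_ge0.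
have e10 : 0 <= e1 by exact: expR_ge0.
pose C := e1 ^+ T / beta.
have C0 : 0 <= C by rewrite divr_ge0 ?exprn_ge0 ?(ltW beta0).
pose v th := C * (\1_(~` G) th * \1_(param_dom klo khi) th) : R.
have v0 th : 0 <= v th by apply: (mulr_ge0 C0); exact: mulr_ge0.
have mv : measurable_fun setT v.
  apply: measurable_funM => //; apply: measurable_funM; apply: measurable_indic => //.
  exact: measurableC.
have vS th : v th != 0 -> sphere th.1.
  rewrite /v; have [[]//|dth] := pselect (param_dom klo khi th).
  by rewrite [X in _ * (_ * X)]indicE memNset// !mulr0 eqxx.
have lower := iid_expect_lower_bound s_gt0 mxs admissible_ae nongeneric_null xs_opt
  (pi0 := pi0) (th0 := th0) Smstar mv v0 vS
  (g := fun D => (posterior_mass s klo khi D Theta)%:E).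
apply: (le_trans (lower T _ _)).
- by move=> D; rewrite lee_fin posterior_mass_ge0.
- move=> D sD gD.
  exact: (posterior_lower_bound s_gt0 mxs nongeneric_null xs_opt pint th0_dom beta0 e10 mB
    B_mass B_lip dom_fin mG GTheta sD gD).
rewrite leeD2l//.
(* Affinities are nonnegative, so for [eta > 1] the complement of [G] is empty and the error
   vanishes. *)
have [eta1|eta1] := ltP 1 eta.
  rewrite [leLHS](_ : _ = 0%E); first by rewrite lee_fin invr_ge0 ler0n.
  apply: integral0_eq.
  move=> th _; rewrite /v; have [dth|dth] := pselect (param_dom klo khi th); last first.
    by rewrite [X in _ * (_ * X)]indicE memNset// !mulr0 mul0r.
  rewrite [X in _ * (X * _)]indicE memNset ?mul0r ?mulr0 ?mul0r//.
  by move=> /=; apply; rewrite /G /=; have := aff0 th; lra.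
pose q := expR (- (32 * M ^+ 2 * n%:R * ln T%:R ^+ 2)) : R.
have q0 : 0 <= q by exact: expR_ge0.
have vq th : v th * affinity s Pab xs th th0 ^+ T <= C * q * \1_(param_dom klo khi) th.
  rewrite /v; have [dth|dth] := pselect (param_dom klo khi th); last first.
    by rewrite [X in _ * (_ * X)]indicE memNset// !mulr0 mul0r mulr_ge0// mulr_ge0.
  rewrite [X in _ * (_ * X)]indicE [X in _ <= _ * X]indicE mem_set// !mulr1.
  have [Gth|Gth] := pselect (G th).
    by rewrite indicE memNset; [rewrite mulr0 mul0r mulr_ge0|move=> /(_ Gth)].
  rewrite indicE mem_set//= mulr1; apply: ler_wpM2l => //.
  (* Outside [G] the affinity is at most [1 - eta <= exp (- eta)]. *)
  have -> : q = expR (- eta) ^+ T.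
    rewrite -expRM_natl /q; congr expR; rewrite /eta; field; rewrite gt_eqF//; lra.
  apply: lerXn2r; rewrite ?nnegrE ?expR_ge0//.
  have : eta <= 1 - affinity s Pab xs th th0.
    by rewrite leNgt; apply/negP.
  by have := expR_ge1Dx (- eta); lra.
have dom_le : (pi0 (param_dom klo khi) <= (n%:R * 2 ^+ n * (khi - klo))%:E)%E.
  have -> : pi0 (param_dom klo khi) = pi0 ((setT `*` setT) `&` param_dom klo khi).
    by rewrite setXTT setTI.
  rewrite prect// !setTI EFinM; apply: lee_pmul => //.
  rewrite (_ : [set k : R | _] = `]klo, khi[%classic).
    by rewrite lebesgue_measure_itv /= lte_fin kk -EFinB.
  by apply/seteqP; split => x /=; rewrite in_itv.
apply: (@le_trans _ _ (\int[pi0]_th (C * q * \1_(param_dom klo khi) th)%:E)%E).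
  apply: le_lower_integral => th _; rewrite lee_fin; last exact: vq.
  by rewrite mulr_ge0// exprn_ge0.
rewrite integral_EFinZl ?(mulr_ge0 C0 q0)//.
rewrite integral_indic// setIT.
apply: (@le_trans _ _ ((C * q)%:E * (n%:R * 2 ^+ n * (khi - klo))%:E)%E).
  by apply: lee_wpmul2l => //; rewrite lee_fin mulr_ge0.
rewrite -EFinM lee_fin.
have H : 32 * M ^+ 2 * n%:R * ln T%:R ^+ 2 <= T%:R.
  by move: eta1; rewrite /eta ler_pdivrMr ?mul1r//; lra.
apply: le_trans (prior_ratio_bound n0 T1 M1 H); rewrite -/q.
have e1T : e1 ^+ T = expR 2.
  by rewrite /e1 -expRM_natl; congr expR; field; rewrite gt_eqF//; lra.
rewrite (_ : C * q * _ = expR 2 * (n%:R * 2 ^+ n * (khi - klo) / beta) * q); last first.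
  by rewrite /C e1T; ring.
apply: ler_wpM2r => //; rewrite -[leRHS]mulrA; apply: ler_wpM2l; first exact: expR_ge0.
rewrite ler_pdivrMr//.
have E2 : (40 * n%:R ^+ 2 * M * T%:R) ^+ n * (d / (10 * n%:R)) ^+ n = 2 ^+ n.
  by rewrite -exprMn; congr (_ ^+ n); rewrite /d; field; rewrite !gt_eqF//; lra.
have -> : (40 * n%:R ^+ 2 * M * T%:R) ^+ n * (2 * n%:R * M ^+ 2 * T%:R) * beta =
   n%:R * 2 ^+ n * (2 * n%:R * M ^+ 2 * T%:R * mn).
  by rewrite -E2 /beta; ring.
apply: ler_wpM2l; first by rewrite mulr_ge0// exprn_ge0.
have X1 : 1 <= 2 * n%:R * M ^+ 2 * T%:R.
  by rewrite (_ : _ * _ = 2 * (n%:R * M * T%:R) * M); [nra|ring].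
(* If the minimum is [d], the product is [M], which dominates [khi - klo]; otherwise a factor at
   least 1 multiplies [khi - klo] itself. *)
rewrite /mn; case: (leP d (khi - klo)) => _; last by rewrite ler_peMl// subr_ge0 ltW.
rewrite (_ : 2 * n%:R * M ^+ 2 * T%:R * d = M); first by rewrite lerBlDr (le_trans kM)// lerDl ltW.
by rewrite /d; field; rewrite !gt_eqF//; lra.
Qed.

End Concentration.

(** * From the surface measure to its finite copy, and the theorem *)

Section SurfaceTransfer.
Context {R : realType} {n : nat} {lam sig s : {measure set (n.-tuple R) -> \bar R}}.
Hypothesis Hsig : is_surface_measure lam sig.

Lemma surface_setIsphere (A : set (n.-tuple R)) : measurable A -> sig (A `&` sphere) = sig A.
Proof.
move=> mA; have mS : measurable (sphere : set (n.-tuple R)) by exact: measurable_sphere.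
by rewrite !Hsig//; [rewrite -setIA setIid|exact: measurableI].
Qed.

Hypothesis sE : forall A, s A = sig A.

Lemma eq_law_int (Pab : probability (n.-tuple R * R)%type R) xs th :
  law_int sig Pab xs th = law_int s Pab xs th.
Proof.
have E : (sig : set (n.-tuple R) -> \bar R) = s by apply/funext => A; rewrite sE.
by apply/funext => h; rewrite /law_int /vmf_density /vmf_norm E.
Qed.

Lemma eq_posterior_mass (klo khi : R) D Theta :
  posterior_mass sig klo khi D Theta = posterior_mass s klo khi D Theta.
Proof.
have E : (sig : set (n.-tuple R) -> \bar R) = s by apply/funext => A; rewrite sE.
by rewrite /posterior_mass /likelihood /vmf_density /vmf_norm E.
Qed.

Lemma eq_wasserstein (Pab : probability (n.-tuple R * R)%type R) xs th1 th2 :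
  wasserstein sig Pab xs th1 th2 = wasserstein s Pab xs th1 th2.
Proof.
rewrite /wasserstein; congr (ereal_inf (image _ _)); apply/funext => g.
by rewrite /coupling !eq_law_int.
Qed.

End SurfaceTransfer.

Lemma surface_generic (R : realType) (n : nat) (lam sig : {measure set (n.-tuple R) -> \bar R}) :
  is_lebesgue_n lam -> is_surface_measure lam sig ->
  forall a : n.-tuple R, (forall i, 0 < tnth a i) -> {ae sig, forall u, generic u a}.
Proof.
move=> Hlam Hsig a a0.
have ae1 : {ae sig, forall u, forall i, tnth u i != 0}.
  apply: filter_forall => i; exists [set u | tnth u i = 0]; split.
  - by apply: (@measurable_eqfun _ _ R) => //; exact: measurable_tnth.
  - exact: (surface_coord0 Hlam Hsig).
  - by move=> u /= /negP; rewrite negbK => /eqP.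
have ae2 : {ae sig, forall u, forall (ij : 'I_n * 'I_n), ij.1 != ij.2 ->
    tnth u ij.1 * tnth a ij.2 != tnth u ij.2 * tnth a ij.1}.
  apply: filter_forall => -[i j] /=; have [ij|ij] := eqVneq i j.
    by apply: nearW => u.
  exists [set u | tnth u i * tnth a j = tnth u j * tnth a i]; split.
  - by apply: (@measurable_eqfun _ _ R); apply: measurable_funM => //; exact: measurable_tnth.
  - exact: (surface_hyperplane Hlam Hsig).
  - by move=> u /= /not_implyP[_ /negP]; rewrite negbK => /eqP.
apply: filterS2 ae1 ae2 => u u1 u2; split => // i j ij.
exact: (u2 (i, j)).
Qed.

Theorem theorem1 (R : realType) (n : nat)
  (lam : {measure set (n.-tuple R) -> \bar R}) (Hlam : is_lebesgue_n lam)
  (sig : {measure set (n.-tuple R) -> \bar R}) (Hsig : is_surface_measure lam sig)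
  (Pab : probability (n.-tuple R * R)%type R) (alo : R) (Halo : 0 < alo)
  (HPab : {ae Pab, forall ab : n.-tuple R * R,
            (forall i, alo <= tnth ab.1 i <= 1) /\ 0 <= ab.2})
  (xs : n.-tuple R -> n.-tuple R * R -> n.-tuple R)
  (Hxs_meas : measurable_fun setT (fun p : n.-tuple R * (n.-tuple R * R) => xs p.1 p.2))
  (Hxs_opt : forall (u : n.-tuple R) (ab : n.-tuple R * R),
      (forall i, 0 <= tnth ab.1 i) -> 0 <= ab.2 -> LP_optimal u ab.1 ab.2 (xs u ab))
  (klo khi : R) (Hklo : 0 < klo) (Hkk : klo < khi)
  (mstar : n.-tuple R) (kstar : R) (Hmstar : sphere mstar) (Hkstar : klo < kstar < khi)
  (alpha : R) (Halpha : 0 <= alpha <= 1 / 2)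
  (T : nat) (HT : (1 < T)%N) :
  let thstar : param := (mstar, kstar) in
  let Theta_T : set param :=
    [set th : param | sphere th.1 /\ klo < th.2 < khi /\
       (wasserstein sig Pab xs th thstar <=
        (Num.max 8 (8 * khi) * (n%:R * ln T%:R) / powR T%:R (1 / 2 - alpha))%:E)%E] in
  ((1 - 2 / T%:R - 1 / (4 * powR T%:R (2 * alpha) * (ln T%:R) ^+ 2))%:E <=
    iid_expect (law_int sig Pab xs thstar) T
      (fun D => (posterior_mass sig klo khi D Theta_T)%:E))%E.
Proof.
cbv zeta; set thstar := (mstar, kstar); set Theta_T := [set th | _ /\ _].
have mS : measurable (sphere : set (n.-tuple R)) by exact: measurable_sphere.
have sigT : (sig setT < +oo)%E.
  by apply: le_lt_trans (surface_le Hlam Hsig measurableT) _; exact: ltry.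
have [s sE] := exists_finite_measure sigT.
have n0 : (0 < n)%N.
  rewrite lt0n; apply/eqP => n0; move: Hmstar; rewrite /sphere/= /dotp.
  rewrite big1 => [/eqP|i _]; first by rewrite eq_sym oner_eq0.
  by have := ltn_ord i; rewrite [X in (_ < X)%N]n0.
have n1 : 1 <= n%:R :> R by rewrite ler1n.
have mcap (m : n.-tuple R) (d : R) :
    measurable [set u : n.-tuple R | forall i, `|tnth u i - tnth m i| <= d].
  rewrite (_ : [set _ | _] = [set x | forall i, tnth [tuple tnth m i - d | i < n] i <= tnth x i
     <= tnth [tuple tnth m i + d | i < n] i]); first exact: measurable_tbox.
  by apply/seteqP; split => x /= H i; have := H i; rewrite !tnth_mktuple ler_distl.
have s_cap (m : n.-tuple R) (d : R) : sphere m -> 0 < d <= 1 ->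
    ((n%:R * (d / (10 * n%:R)) ^+ n)%:E <=
      s ([set u | forall i, (`|tnth u i - tnth m i| <= d)%R] `&` sphere))%E.
  by move=> Sm d01; rewrite sE (surface_setIsphere Hsig)//; exact: (surface_cap Hlam Hsig).
have s_sphere : (s sphere <= (n%:R * 2 ^+ n)%:E)%E.
  by rewrite sE; exact: (surface_le Hlam Hsig).
have s_gt0 : (0 < s sphere)%E.
  have c0 : (0 < (n%:R * (1 / (10 * n%:R)) ^+ n)%:E :> \bar R)%E.
    by rewrite lte_fin mulr_gt0 ?exprn_gt0 ?divr_gt0 ?mulr_gt0//; lra.
  apply: (lt_le_trans c0); have s1 : 0 < (1 : R) <= 1 by rewrite ltr01 lexx.
  apply: (le_trans (s_cap _ _ Hmstar s1)); apply: le_measure; rewrite ?inE//.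
  by apply: measurableI.
have adm_ae : {ae Pab, forall ab, admissible ab}.
  apply: filterS HPab => ab [a1 b0]; split => // i.
  by have /andP[ai _] := a1 i; exact: lt_le_trans ai.
have gen_ae (a : n.-tuple R) : (forall i, 0 < tnth a i) -> {ae s, forall u, generic u a}.
  move=> a0; have [N [mN N0 sN]] := surface_generic Hlam Hsig a0.
  by exists N; split => //; rewrite [LHS]sE.
have xs_opt u ab : admissible ab -> LP_optimal u ab.1 ab.2 (xs u ab).
  by move=> [a0 b0]; apply: Hxs_opt => // i; exact: ltW.
(* Thus [max (8, 8 khi) = 8 M]. *)
pose M := Num.max 1 khi.
have M1 : 1 <= M by rewrite le_max lexx.
have kM : khi <= M by rewrite le_max lexx orbT.
have T0 : 0 < T%:R :> R by rewrite ltr0n ltnW.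
have T1 : 1 <= T%:R :> R by rewrite ler1n ltnW.
have L0 : 0 < ln T%:R :> R by rewrite ln_gt0// ltr1n.
have Theta_sup : param_dom klo khi `&` [set th | 1 - affinity s Pab xs th thstar <
    32 * M ^+ 2 * n%:R * ln T%:R ^+ 2 / T%:R] `<=` Theta_T.
  move=> th [[Sth kth] /= aff]; split => //; split => //.
  rewrite (eq_wasserstein sE).
  pose r := Num.sqrt n%:R : R; pose w := Num.sqrt T%:R : R.
  have r0 : 0 < r by rewrite sqrtr_gt0; lra.
  have w0 : 0 < w by rewrite sqrtr_gt0.
  have r2 : r ^+ 2 = n%:R by rewrite sqr_sqrtr//; lra.
  have w2 : w ^+ 2 = T%:R by rewrite sqr_sqrtr// ltW.
  pose e := 8 * M * n%:R * ln T%:R / w.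
  have e0 : 0 < e by rewrite /e !mulr_gt0 ?invr_gt0//; lra.
  (* This [t] equalizes the two terms of the Wasserstein estimate at the threshold: each contributes
     [e / 2]. *)
  pose t := e / (2 * r).
  have t0 : 0 < t by rewrite divr_gt0// mulr_gt0.
  have t2 : 0 < (2 * t)^-1 by rewrite invr_gt0; lra.
  apply: (le_trans (wasserstein_le_affinity s_gt0 Hxs_meas adm_ae gen_ae xs_opt
    (th' := thstar) Sth Hmstar t0)).
  rewrite lee_fin; apply: (@le_trans _ _ e).
    rewrite -/r (_ : e = r * (32 * M ^+ 2 * n%:R * ln T%:R ^+ 2 / T%:R / (2 * t) + t)).
      by rewrite ler_pM2l// lerD2r (ler_pM2r t2) ltW.
    have key (m l x y : R) : 0 < m -> 0 < l -> 0 < x -> 0 < y ->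
        8 * m * x ^+ 2 * l / y = x * (32 * m ^+ 2 * x ^+ 2 * l ^+ 2 / y ^+ 2 /
          (2 * (8 * m * x ^+ 2 * l / y / (2 * x))) + 8 * m * x ^+ 2 * l / y / (2 * x)).
      by move=> *; field; rewrite !gt_eqF.
    have M0 : 0 < M by lra.
    by have := key M (ln T%:R) r w M0 L0 r0 w0; rewrite r2 w2.
  have -> : Num.max 8 (8 * khi) = 8 * M.
    by rewrite /M; case: (leP 8 (8 * khi)) => ?; case: (leP 1 khi) => ?; lra.
  rewrite /e -!mulrA; apply: ler_wpM2l => //; apply: ler_wpM2l; first by lra.
  apply: ler_wpM2l; first by lra.
  apply: ler_wpM2l; first exact: ltW.
  (* The radius grows with [alpha], since [T >= 1], so the value [e] at [alpha = 0] suffices. *)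
  rewrite lef_pV2 ?posrE ?powR_gt0// /w -powR12_sqrt ?(ltW T0)//.
  by apply: ler_powR => //; move/andP: Halpha => [a0 _]; lra.
have := expected_posterior_bound s_gt0 Hxs_meas adm_ae gen_ae xs_opt s_cap s_sphere Hklo Hkk
  Hmstar Hkstar HT M1 kM Theta_sup.
rewrite (eq_law_int sE).
have -> : (fun D => (posterior_mass sig klo khi D Theta_T)%:E) =
    (fun D => (posterior_mass s klo khi D Theta_T)%:E).
  by apply/funext => D; rewrite (eq_posterior_mass sE).
move: (iid_expect _ _ _) => E H.
apply: (@le_trans _ _ (1 - (T%:R^-1)%:E)%E); last by rewrite leeBlDr.
rewrite -EFinB lee_fin.
have p0 : 0 <= 1 / (4 * powR T%:R (2 * alpha) * ln T%:R ^+ 2).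
  by rewrite divr_ge0// mulr_ge0 ?sqr_ge0// mulr_ge0// powR_ge0.
have q0 : 0 < (T%:R : R)^-1 by rewrite invr_gt0.
move: p0; move: (1 / (4 * _ * _)) => y y0.
by rewrite mulrC; lra.
Qed.
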